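(* Let $A$ be a scalar type spectral operator in a complex Banach space $X$. Then $A$ generates an eventually differentiable $C_0$-semigroup $\{T(t)\}_{t\ge0}$ (of scalar type spectral operators) on $X$ if and only if there exist $\omega\in\mathbb{R}$, $b>0$, and $a\in\mathbb{R}$ such that $$\sigma(A)\subseteq\{\lambda\in\mathbb{C} : \operatorname{Re}\lambda\le\min(\omega,\,a-b\ln|\operatorname{Im}\lambda|)\},$$ in which case (i.e., for any such $b$) the orbit maps $[0,\infty)\ni t\mapsto T(t)f\in X$ are differentiable on $[b^{-1},\infty)$ for all $f\in X$.
   Context: A scalar type spectral operator in a complex Banach space $X$ is a densely defined closed linear operator $A$ in $X$ for which there is a strongly $\sigma$-additive spectral measure $E_A(\cdot)$ (the resolution of the identity), assigning to Borel subsets of $\mathbb{C}$ bounded projection operators on $X$ (with $E_A(\emptyset)=0$, $E_A(\mathbb{C})=I$, $E_A(\delta\cap\delta')=E_A(\delta)E_A(\delta')$), whose support is the spectrum $\sigma(A)$, and such that $A=\int_{\sigma(A)}\lambda\,dE_A(\lambda)$. Here, for a Borel measurable $F:\sigma(A)\to\mathbb{C}$, $F(A)=\int_{\sigma(A)}F(\lambda)\,dE_A(\lambda)$ is the operator $F(A)f=\lim_{n\to\infty}\int_{\{|F|\le n\}}F(\lambda)\,dE_A(\lambda)f$, with domain all $f\in X$ for which the limit exists. A $C_0$-semigroup $\{T(t)\}_{t\ge 0}$ on $X$ is eventually differentiable if there exists $t_0>0$ such that, for every $f\in X$, the orbit map $[0,\infty)\ni t\mapsto T(t)f\in X$ is differentiable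 on $[t_0,\infty)$. Convention: $\ln 0=-\infty$, so that for real $\lambda$ the minimum equals $\omega$. *)

(* Defs.v *)
From HB Require Import structures.
From mathcomp Require Import all_boot all_order all_algebra.
From mathcomp Require Import complex.
From mathcomp Require Import all_classical all_reals all_analysis.

Set Implicit Arguments.
Unset Strict Implicit.
Unset Printing Implicit Defensive.

Import Order.TTheory GRing.Theory Num.Theory.
Import numFieldNormedType.Exports.

Local Open Scope classical_set_scope.
Local Open Scope ring_scope.
Local Open Scope complex_scope.

(** [R[i]^o] is [R[i]] as a normed module over itself: the library puts the
    usual topology of the complex plane on this alias. *)
Definition borelC (R : realType) : set_system R[i] :=
  <<s [set U : set R[i] | open (U : set R[i]^o)] >>.

Section operators.
Context {R : realType} {X : completeNormedModType R[i]}.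

(** The values of [app] outside [dom] are irrelevant; operators are compared
    with [op_eq]. *)
Record operator := Operator { dom : set X ; app :> X -> X }.

Definition op_eq (A B : operator) : Prop :=
  dom A = dom B /\ forall f, dom A f -> A f = B f.

Definition op_linear (A : operator) : Prop :=
  dom A 0 /\
  forall (c : R[i]) f g, dom A f -> dom A g ->
    dom A (c *: f + g) /\ A (c *: f + g) = c *: A f + A g.

Definition op_closed (A : operator) : Prop :=
  closed [set p : X * X | dom A p.1 /\ p.2 = A p.1].

Definition everywhere_defined (S : X -> X) : operator := Operator setT S.

Definition resolvent_set (A : operator) : set R[i] :=
  [set z | exists S : {linear X -> X}, continuous S /\
    (forall f, dom A (S f) /\ A (S f) - z *: S f = f) /\
    (forall f, dom A f -> S (A f - z *: f) = f)].

Definition spectrum (A : operator) : set R[i] := ~` resolvent_set A.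

(** Only the values of [E] on Borel sets matter. *)
Record spectral_measure (E : set R[i] -> {linear X -> X}) : Prop := {
  spm_bounded : forall d, borelC d -> continuous (E d) ;
  spm_set0 : forall f, E set0 f = 0 ;
  spm_setT : forall f, E setT f = f ;
  spm_setI : forall d d', borelC d -> borelC d' ->
    forall f, E (d `&` d') f = E d (E d' f) ;
  spm_sigma_additive : forall d : nat -> set R[i],
    (forall n, borelC (d n)) -> trivIset setT d ->
    forall f, (\sum_(0 <= k < n) E (d k) f) @[n --> \oo]
              --> E (\bigcup_k d k) f }.

(** The complement of the union of all open sets of measure zero. *)
Definition spm_support (E : set R[i] -> {linear X -> X}) : set R[i] :=
  [set z | forall U : set R[i], open (U : set R[i]^o) -> U z ->
    ~ (forall f, E U f = 0)].

Definition simple (s : R[i] -> R[i]) : Prop :=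
  finite_set (range s) /\ forall z, borelC (s @^-1` [set z]).

Definition simple_integral (E : set R[i] -> {linear X -> X}) (D : set R[i])
    (s : R[i] -> R[i]) (f : X) : X :=
  \sum_(z \in range s) z *: E (D `&` s @^-1` [set z]) f.

(** [y] is the integral over [D] of the bounded Borel function [F] against
    [E(.) f]: the limit of the integrals of simple functions that converge to
    [F] uniformly on [D]. *)
Definition is_bounded_integral (E : set R[i] -> {linear X -> X})
    (D : set R[i]) (F : R[i] -> R[i]) (f y : X) : Prop :=
  exists s : nat -> R[i] -> R[i],
    [/\ forall n, simple (s n),
        forall e : R, 0 < e ->
          \forall n \near \oo, forall z, D z -> `|s n z - F z| < e%:C
      & simple_integral E D (s n) f @[n --> \oo] --> y].

(** The value does not depend on the approximating sequence; the default [0]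
    only concerns functions that are unbounded or not Borel on [D]. *)
Definition bounded_integral (E : set R[i] -> {linear X -> X})
    (D : set R[i]) (F : R[i] -> R[i]) (f : X) : X :=
  xget 0 [set y | is_bounded_integral E D F f y].

Definition spectral_integral (E : set R[i] -> {linear X -> X})
    (D : set R[i]) (F : R[i] -> R[i]) : operator :=
  let u f n := bounded_integral E (D `&` [set z | `|F z| <= n%:R]) F f in
  Operator [set f | cvgn (u f)] (fun f => limn (u f)).

Definition scalar_type_spectral (A : operator) : Prop :=
  [/\ op_linear A, dense (dom A), op_closed A &
      exists E : set R[i] -> {linear X -> X},
        [/\ spectral_measure E, spm_support E = spectrum A &
            op_eq A (spectral_integral E (spectrum A) id)]].

(** Only the values of [T] on nonnegative times matter. *)
Record C0_semigroup (T : R -> {linear X -> X}) : Prop := {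
  sg_bounded : forall t, 0 <= t -> continuous (T t) ;
  sg_0 : forall f, T 0 f = f ;
  sg_D : forall s t, 0 <= s -> 0 <= t -> forall f, T (s + t) f = T s (T t f) ;
  sg_continuous : forall f, T t f @[t --> 0^'+] --> f }.

Definition generator (T : R -> {linear X -> X}) : operator :=
  let q f h := (h%:C)^-1 *: (T h f - f) in
  Operator [set f | cvg (q f h @[h --> 0^'+])]
           (fun f => lim (q f h @[h --> 0^'+])).

Definition generates (A : operator) (T : R -> {linear X -> X}) : Prop :=
  C0_semigroup T /\ op_eq A (generator T).

(** Differentiability at [t] of a map of a real variable with values in a
    complex space, which the library's [derivable] does not cover. *)
Definition differentiable_at (u : R -> X) (t : R) : Prop :=
  cvg ((h%:C)^-1 *: (u (t + h) - u t) @[h --> 0^']).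

(** As [t0 > 0], the increments [t + h] involved at [t >= t0] are eventually
    nonnegative, so this is differentiability of orbits defined on [[0, +oo[]. *)
Definition orbits_differentiable_from (T : R -> {linear X -> X}) (t0 : R) :=
  forall f t, t0 <= t -> differentiable_at (fun s => T s f) t.

Definition eventually_differentiable (T : R -> {linear X -> X}) : Prop :=
  exists2 t0 : R, 0 < t0 & orbits_differentiable_from T t0.

End operators.
Arguments operator {R} X.

(** [lne 0 = -oo], so on the real axis the minimum is [omega]. *)
Definition log_region (R : realType) (omega a b : R) : set R[i] :=
  [set z | ((complex.Re z)%:E <=
     Order.min omega%:E (a%:E - b%:E * lne `|complex.Im z|%:E))%E].

(* Main.v *)
(** Let [E] be the resolution of the identity of [A] and [D] its support, the
    spectrum. Countable additivity and the uniform boundedness principle bound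
    the [E U] uniformly, so bounded Borel functions integrate against [E] to a
    multiplicative functional calculus with a dominated convergence theorem.

    If [Re z <= omega] on [D], the operators [exp(t A)], the integrals of
    [exp(t z)], form a C0-semigroup generated by [A]; and [f |-> exp(t A) f] is
    differentiable at [t] as soon as [|z| exp(t Re z)] is bounded on [D], the
    difference quotients being uniformly bounded there. On a logarithmic region
    this holds for all [t >= 1 / b].

    Conversely, let [A] generate [T] and let [U] be a bounded Borel subset of
    [D]. On the range of [E U] the operator [A] is bounded, and comparing
    semigroups gives [E U o T t = E U o exp(t A)]. Shrinking [U] to a point [z]
    of [D] turns bounds on [T 1] and on the derivative of [T] at [t0] into
    bounds on [exp(Re z)] and [|z| exp(t0 Re z)], that is, into a logarithmic
    region. The spectral measure of [T t] is the image of [E] under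
    [z |-> exp(t z)]. *)

From HB Require Import structures.
From mathcomp Require Import all_boot all_order all_algebra.
From mathcomp Require Import complex.
From mathcomp Require Import all_classical all_reals all_analysis.
From mathcomp Require Import lra ring.
Require Import Defs.
Import Order.TTheory GRing.Theory Num.Theory.
Import numFieldNormedType.Exports.
Set Implicit Arguments.
Unset Strict Implicit.
Unset Printing Implicit Defensive.
Local Open Scope classical_set_scope.
Local Open Scope ring_scope.

(** * Real-valued norms and uniform boundedness *)

(** The endpoint [t = 1 / b] is the delicate case. There [|z| exp(t Re z)] is bounded on the
    spectrum, but for [k > 0] the function [|z| exp((t - k) Re z)] may fail to be, so the left
    difference quotients cannot be dominated through the derivative at an earlier time. An
    interpolation between [k |z|] and [1] recovers exactly the missing factor [exp(k Re z)], up to a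
    constant.

    In the converse direction neither a half-plane nor eigenvectors are at hand: [exp(t z)] might be
    unbounded on the spectrum, and a single point may have measure zero. Hence the comparison on
    bounded pieces, and the use of approximate eigenvectors: on a small neighbourhood of a point,
    with nonzero projection, a continuous function is constant up to an error [1]. The resulting
    constants do not depend on the point. Differentiability is given orbit by orbit, and uniform
    boundedness turns it into an operator bound.

    All of this needs integrals bounded by the supremum of the function with a constant independent
    of the partition; a convexity argument on step functions provides it. *)

Section real_norm.
Context {R : realType} {V : normedZmodType R[i]}.
Implicit Types x y : V.

(** The library's norm of a complex space is complex-valued; estimates are done
    with its real part. *)
Definition nrm x : R := complex.Re `|x|.

Lemma nrmE x : `|x| = (nrm x)%:C%C.
Proof. by rewrite /nrm RRe_real // normr_real. Qed.

Lemma nrm_ge0 x : 0 <= nrm x.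
Proof. by rewrite -lecR -nrmE normr_ge0. Qed.

Lemma nrm_ltE x (e : R) : (nrm x < e) = (`|x| < e%:C%C).
Proof. by rewrite nrmE ltcR. Qed.

Lemma nrm_leE x (e : R) : (nrm x <= e) = (`|x| <= e%:C%C).
Proof. by rewrite nrmE lecR. Qed.

Lemma nrmD x y : nrm (x + y) <= nrm x + nrm y.
Proof. by rewrite nrm_leE rmorphD /= -!nrmE ler_normD. Qed.

Lemma nrmN x : nrm (- x) = nrm x.
Proof. by rewrite /nrm normrN. Qed.

Lemma nrmBC x y : nrm (x - y) = nrm (y - x).
Proof. by rewrite -nrmN opprB. Qed.

Lemma nrmB x y : nrm (x - y) <= nrm x + nrm y.
Proof. by rewrite -[nrm y]nrmN nrmD. Qed.

Lemma nrm_sub_le z x y : nrm (x - y) <= nrm (x - z) + nrm (z - y).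
Proof. by rewrite -(subrKA z) nrmD. Qed.

Lemma nrm0 : nrm (0 : V) = 0.
Proof. by rewrite /nrm normr0. Qed.

Lemma nrm_eq0 x : (nrm x == 0) = (x == 0).
Proof.
by rewrite -(inj_eq (@complexI R)) -nrmE normr_eq0.
Qed.

Lemma nrm_sum (I : Type) (s : seq I) (F : I -> V) :
  nrm (\sum_(i <- s) F i) <= \sum_(i <- s) nrm (F i).
Proof.
elim/big_rec2 : _ => [|i a b _ h]; first by rewrite nrm0.
by rewrite (le_trans (nrmD _ _))// lerD2l.
Qed.

Lemma nrm_small0 x : (forall e : R, 0 < e -> nrm x <= e) -> x = 0.
Proof.
move=> h; apply/eqP; rewrite -nrm_eq0 eq_le nrm_ge0 andbT.
by apply/ler_addgt0Pr => e /h; rewrite add0r.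
Qed.

End real_norm.

Section complex_modulus.
Context {R : realType}.
Implicit Types z w : R[i].

Lemma nrmM z w : nrm (z * w) = nrm z * nrm w.
Proof. by apply: (@complexI R); rewrite rmorphM /= -!nrmE normrM. Qed.

Lemma nrmV z : nrm z^-1 = (nrm z)^-1.
Proof. by apply: (@complexI R); rewrite fmorphV /= -!nrmE normfV. Qed.

Lemma nrm1 : nrm (1 : R[i]) = 1.
Proof. by rewrite /nrm normr1. Qed.

Lemma nrmC (x : R) : nrm (x%:C)%C = `|x|.
Proof. by rewrite /nrm normc_def /= expr0n /= addr0 sqrtr_sqr. Qed.

Lemma nrm_Re z : `|complex.Re z| <= nrm z.
Proof. by rewrite -lecR -nrmE normc_ge_Re. Qed.

Lemma nrm_sqr z : nrm z ^+ 2 = complex.Re z ^+ 2 + complex.Im z ^+ 2.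
Proof. by rewrite /nrm normc_def /= sqr_sqrtr // addr_ge0 // sqr_ge0. Qed.

Lemma nrm_Im z : `|complex.Im z| <= nrm z.
Proof.
rewrite -(ler_pXn2r (ltn0Sn 1)) ?nnegrE ?nrm_ge0 // nrm_sqr.
by rewrite real_normK ?num_real // lerDr sqr_ge0.
Qed.

Lemma nrm_ReIm z : nrm z <= `|complex.Re z| + `|complex.Im z|.
Proof.
rewrite -(ler_pXn2r (ltn0Sn 1)) ?nnegrE ?nrm_ge0 ?addr_ge0 // nrm_sqr.
rewrite sqrrD !real_normK ?num_real // addrAC lerDl.
by rewrite mulrn_wge0 // mulr_ge0.
Qed.

End complex_modulus.

Section normed_space.
Context {R : realType} {X : normedModType R[i]}.

Lemma nrmZ (c : R[i]) (x : X) : nrm (c *: x) = nrm c * nrm x.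
Proof. by apply: (@complexI R); rewrite rmorphM /= -!nrmE normrZ. Qed.

Lemma nrm_cvgP (T : Type) (F : set_system T) {FF : Filter F} (u : T -> X)
    (l : X) :
  (u @ F --> l) <-> (forall e : R, 0 < e -> \forall t \near F, nrm (u t - l) < e).
Proof.
split=> [/cvgrPdist_lt h e e0|h].
  have /h : 0 < (e%:C)%C :> R[i] by rewrite ltcR.
  by apply: filterS => t; rewrite -nrm_ltE nrmBC.
apply/cvgrPdist_lt => e e0.
have eE : e = ((complex.Re e)%:C)%C by rewrite RRe_real // gtr0_real.
have /h : 0 < complex.Re e by rewrite -ltcR -eE.
by apply: filterS => t; rewrite eE -nrm_ltE nrmBC.
Qed.

Lemma nrm_cvg_unique (T : Type) (F : set_system T) {FF : ProperFilter F}
    (u : T -> X) (l l' : X) : (u @ F --> l) -> (u @ F --> l') -> l = l'.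
Proof. exact: (cvg_unique _ (F := u @ F)). Qed.

Lemma eq_cvg_to (T : Type) (F : set_system T) (u v : T -> X) (l : X) :
  (forall t, u t = v t) -> (u @ F --> l) -> (v @ F --> l).
Proof. by move=> /funext ->. Qed.

Lemma near_eq_cvg_to (T : Type) (F : set_system T) {FF : Filter F}
    (u v : T -> X) (l : X) :
  (\forall t \near F, u t = v t) -> (u @ F --> l) -> (v @ F --> l).
Proof.
move=> uv /nrm_cvgP h; apply/nrm_cvgP => e /h.
by apply: filterS2 uv => t ->.
Qed.

Lemma nrm_cvg_le (T : Type) (F : set_system T) {FF : ProperFilter F}
    (u : T -> X) (l : X) (C : R) :
  (u @ F --> l) -> (\forall t \near F, nrm (u t) <= C) -> nrm l <= C.
Proof.
move=> /nrm_cvgP h uC; apply/ler_addgt0Pr => e /h h'.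
near F => t.
have -> : l = u t - (u t - l) by rewrite opprB addrC subrK.
rewrite (le_trans (nrmB _ _)) // lerD //; last apply: ltW; by near: t.
Unshelve. all: by end_near. Qed.

Lemma nrm_cvg_bounded (u : nat -> X) (l : X) :
  (u @ \oo --> l) -> exists C : R, forall n, nrm (u n) <= C.
Proof.
move=> /nrm_cvgP /(_ 1 ltr01) [N _ hN].
exists (nrm l + 1 + \sum_(i < N) nrm (u i)) => n.
have S0 : 0 <= \sum_(i < N) nrm (u i) by apply: sumr_ge0 => i _; exact: nrm_ge0.
have [Nn|nN] := leqP N n.
  rewrite ler_wpDr //; have /ltW h := hN n Nn.
  by rewrite -[u n](subrK l) addrC (le_trans (nrmD _ _)) // lerD.
rewrite ler_wpDl //; first by rewrite addr_ge0 // nrm_ge0.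
rewrite (bigD1 (Ordinal nN)) //= lerDl.
by apply: sumr_ge0 => i _; exact: nrm_ge0.
Qed.

Lemma nrm_openP (U : set X) :
  open U <-> (forall z, U z -> exists2 e : R, 0 < e &
                forall w, nrm (w - z) < e -> U w).
Proof.
rewrite openE; split=> [h z /h /nbhs_ballP[e /= e0 he]|h z /h[e e0 he]].
  have eE : e = ((complex.Re e)%:C)%C by rewrite RRe_real // gtr0_real.
  exists (complex.Re e); first by rewrite -ltcR -eE.
  by move=> w wz; apply: he; rewrite -ball_normE /= eE -nrm_ltE nrmBC.
apply/nbhs_ballP; exists (e%:C)%C; first by rewrite /= ltcR.
by move=> w; rewrite -ball_normE /= -nrm_ltE nrmBC => /he.
Qed.

Lemma nrm_continuousP (S : {linear X -> X}) :
  continuous S <-> (exists C : R, forall x, nrm (S x) <= C * nrm x).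
Proof.
split=> [cS|[C hC] x].
  have /linear_boundedP : bounded_near S (nbhs (0 : X)).
    by apply: continuous_linear_bounded; exact: cS.
  move=> [M [Mreal hM]].
  have M1 : M < M + 1 by rewrite ltrDl.
  exists (complex.Re (M + 1)) => x.
  have := hM _ M1 x.
  have -> : M + 1 = ((complex.Re (M + 1))%:C)%C.
    by rewrite RRe_real // realD // real1.
  by rewrite [X in _ * X]nrmE -rmorphM -nrm_leE.
apply/nrm_cvgP => e e0.
have C1 : 0 < `|C| + 1 by rewrite ltr_wpDl.
have /nrm_cvgP /(_ (e / (`|C| + 1))) : id @ x --> x by exact: cvg_id.
rewrite divr_gt0 // => /(_ isT); apply: filterS => y /= xy.
rewrite -linearB (le_lt_trans (hC _)) //.
rewrite ltr_pdivlMr // mulrC in xy; apply: le_lt_trans xy.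
by rewrite ler_wpM2r ?nrm_ge0 // (le_trans (ler_norm _)) // lerDl.
Qed.

Lemma linear_cvg (S : {linear X -> X}) (T : Type) (F : set_system T)
    {FF : Filter F} (u : T -> X) (l : X) :
  continuous S -> (u @ F --> l) -> S (u t) @[t --> F] --> S l.
Proof. by move=> cS ul; apply: (cvg_comp _ _ ul); exact: cS. Qed.

Lemma linear_pack (g : X -> X) : linear g ->
  exists L : {linear X -> X}, forall x, L x = g x.
Proof.
move=> lg; pose L : {linear X -> X} := HB.pack g (GRing.isLinear.Build _ _ _ _ _ lg).
by exists L.
Qed.

End normed_space.

Section banach_space.
Context {R : realType} {X : completeNormedModType R[i]}.

Lemma nrm_cauchy (u : nat -> X) :
  (forall e : R, 0 < e -> exists N, forall m n, (N <= m)%N -> (N <= n)%N ->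
     nrm (u m - u n) < e) -> cvgn u.
Proof.
move=> h; apply: cauchy_cvg; apply: cauchy_exP => e e0.
have eE : e = ((complex.Re e)%:C)%C by rewrite RRe_real // gtr0_real.
have /h[N hN] : 0 < complex.Re e by rewrite -ltcR -eE.
exists (u N), N => // n /= Nn.
by rewrite -ball_normE /= eE -nrm_ltE; exact: hN.
Qed.

(* Nested balls: if the family were not uniformly bounded, every ball would
   contain a smaller one on which some member exceeds a given bound. *)
Lemma uniform_boundedness (I : Type) (T : I -> {linear X -> X}) :
  (forall i, continuous (T i)) ->
  (forall x, exists C : R, forall i, nrm (T i x) <= C) ->
  exists C : R, forall i x, nrm (T i x) <= C * nrm x.
Proof.
move=> cT pT; apply: contrapT => nT.
pose good (n : nat) (p q : X * R) := [/\ 0 < q.2, q.2 <= p.2 / 2,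
  nrm (q.1 - p.1) <= p.2 / 2 &
  exists i, forall z, nrm (z - q.1) <= q.2 -> n%:R <= nrm (T i z)].
have step (np : nat * (X * R)) : exists q, 0 < np.2.2 -> good np.1 np.2 q.
  case: np => n [x r] /=; have [r0|_] := ltP 0 r; last by exists (0, 0).
  have [i [y [yx Ty]]] : exists i y, nrm (y - x) <= r / 2 /\ n%:R < nrm (T i y).
    (* If every member were at most [n] on the ball of radius [r / 2], then [c *: v], of norm
       [r / 2], would be a difference of two points of that ball and its image would have norm at
       most [2 n]; rescaling gives [4 n / r]. *)
    apply: contrapT => nex; apply: nT; exists (4 * n%:R / r) => i v.
    have bd y : nrm (y - x) <= r / 2 -> nrm (T i y) <= n%:R.
      by move=> yx; rewrite leNgt; apply/negP => Ty; apply: nex; exists i, y.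
    have [->|v0] := eqVneq v 0; first by rewrite linear0 nrm0 mulr0.
    have nv0 : 0 < nrm v by rewrite lt_def nrm_eq0 v0 nrm_ge0.
    pose c : R := r / 2 / nrm v.
    have c0 : 0 < c by rewrite !divr_gt0.
    have : nrm (T i (c%:C%C *: v)) <= n%:R + n%:R.
      have cvE : c%:C%C *: v = (x + c%:C%C *: v) - x by rewrite addrC addKr.
      have h1 : nrm (x + c%:C%C *: v - x) <= r / 2.
        by rewrite -cvE nrmZ nrmC gtr0_norm // /c divfK ?gt_eqF.
      have h2 : nrm (x - x) <= r / 2 by rewrite subrr nrm0 divr_ge0 // ltW.
      by rewrite cvE linearB (le_trans (nrmB _ _)) // lerD // bd.
    rewrite linearZ /= nrmZ nrmC gtr0_norm // -ler_pdivlMl // => /le_trans; apply.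
    rewrite /c !invfM !invrK -mulr2n -mulr_natr le_eqVlt; apply/orP; left; apply/eqP.
    field. by rewrite gt_eqF.
  have [C hC] := (nrm_continuousP (T i)).1 (cT i).
  (* Within distance [d] of [y] the norm of the image under [T i] drops by at most its excess over
     [n]. *)
  pose d := (nrm (T i y) - n%:R) / (`|C| + 1).
  have C1 : 0 < `|C| + 1 by rewrite ltr_wpDl.
  have d0 : 0 < d by rewrite divr_gt0 // subr_gt0.
  exists (y, Num.min d (r / 2)) => _; split => //=.
  - by rewrite lt_min d0 divr_gt0.
  - by rewrite ge_min lexx orbT.
  - exists i => z; rewrite le_min => /andP[zd _].
    have h1 : nrm (T i y) <= nrm (T i z) + nrm (T i (z - y)).
      by rewrite linearB -{1}[T i y](subKr (T i z)) nrmB.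
    have h2 : nrm (T i (z - y)) <= nrm (T i y) - n%:R.
      have -> : nrm (T i y) - n%:R = (`|C| + 1) * d.
        by rewrite mulrC divfK // gt_eqF.
      rewrite (le_trans (hC _)) // (@le_trans _ _ ((`|C| + 1) * nrm (z - y))) //.
        by rewrite ler_wpM2r ?nrm_ge0 // (le_trans (ler_norm _)) // lerDl.
      by rewrite ler_pM2l.
    by rewrite -(lerD2r (nrm (T i (z - y)))) (le_trans _ h1) // -lerBrDl.
have [f hf] := choice step.
pose s := fix s n := if n is n'.+1 then f (n', s n') else (0, 1).
have sp n : 0 < (s n).2.
  by elim: n => //= n IH; have [] := hf (n, s n) IH.
have sg n : good n (s n) (s n.+1) by exact: (hf (n, s n) (sp n)).
have sr n : (s n).2 <= 2^-1 ^+ n.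
  elim: n => [|n IH]; first by rewrite expr0.
  by have [_ h _ _] := sg n; rewrite (le_trans h) // exprSr ler_pM2r ?invr_gt0.
(* Each step moves the centre by at most half the radius and loses at least half the radius, so the
   loss of radius pays for the whole displacement. *)
have sx n k : nrm ((s (n + k)%N).1 - (s n).1) <= (s n).2 - (s (n + k)%N).2.
  elim: k => [|k IH]; first by rewrite addn0 !subrr nrm0.
  rewrite addnS (le_trans (nrm_sub_le (s (n + k)%N).1 _ _)) //.
  by have [_ h1 h2 _] := sg (n + k)%N; move: IH h1 h2; rewrite /=; lra.
have sx' n m : (n <= m)%N -> nrm ((s m).1 - (s n).1) <= (s n).2.
  by move=> /subnKC <-; rewrite (le_trans (sx _ _)) // gerBl ltW.
have : cvgn (fun n => (s n).1).
  apply: nrm_cauchy => e e0.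
  have /cvgrPdist_lt /(_ (e / 2)) : (2^-1 : R) ^+ n @[n --> \oo] --> (0 : R).
    by apply: cvg_expr; rewrite ger0_norm ?invr_ge0 // invf_lt1 // ltr1n.
  rewrite divr_gt0 // => /(_ isT)[N _ hN]; exists N => m n Nm Nn.
  have := hN N (leqnn N); rewrite /= sub0r normrN ger0_norm ?exprn_ge0 ?invr_ge0 //.
  have := nrm_sub_le (s N).1 (s m).1 (s n).1.
  have := sr N; have := sx' _ _ Nm; have := sx' _ _ Nn.
  rewrite [nrm ((s N).1 - _)]nrmBC; lra.
move=> /cvg_ex[/= x sx0].
have xs n : nrm (x - (s n).1) <= (s n).2.
  have : (s m).1 - (s n).1 @[m --> \oo] --> x - (s n).1.
    by apply: cvgB sx0 _; exact: cvg_cst.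
  move=> /nrm_cvg_le; apply; exists n => // m /= nm; exact: sx'.
have [C hC] := pT x.
have [_ _ _ [i hi]] := sg (Num.truncn C).+1.
have := hi x (xs _); rewrite leNgt => /negP; apply.
by rewrite (le_lt_trans (hC i)) // truncnS_gt.
Qed.

End banach_space.

(** * Borel sets and spectral measures *)

Section borel_sets.
Context {R : realType}.
Implicit Types A B D U : set R[i].

Let salg : sigma_algebra setT (@borelC R).
Proof. exact: smallest_sigma_algebra. Qed.

Lemma borelC_open U : open (U : set R[i]^o) -> borelC U.
Proof. by move=> oU; apply: sub_sigma_algebra. Qed.

Lemma borelC0 : borelC (set0 : set R[i]).
Proof. by case: salg. Qed.

Lemma borelCC A : borelC A -> borelC (~` A).
Proof. by case: salg => _ h _ /h; rewrite setTD. Qed.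

Lemma borelC_bigcup (F : nat -> set R[i]) :
  (forall n, borelC (F n)) -> borelC (\bigcup_n F n).
Proof. by case: salg => _ _ h /h. Qed.

Lemma borelCT : borelC (setT : set R[i]).
Proof. by rewrite -setC0; apply: borelCC; exact: borelC0. Qed.

Lemma borelCU A B : borelC A -> borelC B -> borelC (A `|` B).
Proof.
move=> hA hB; rewrite -bigcup2E; apply: borelC_bigcup => -[|[|n]] //=.
exact: borelC0.
Qed.

Lemma borelCI A B : borelC A -> borelC B -> borelC (A `&` B).
Proof.
by move=> hA hB; rewrite -[A `&` B]setCK setCI; apply: borelCC; apply: borelCU; apply: borelCC.
Qed.

Lemma borelCD A B : borelC A -> borelC B -> borelC (A `\` B).
Proof. by move=> hA hB; rewrite setDE; apply: borelCI => //; exact: borelCC. Qed.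

Lemma borelC_closed A : closed (A : set R[i]^o) -> borelC A.
Proof.
by move=> cA; rewrite -[A]setCK; apply: borelCC; apply: borelC_open; rewrite openC.
Qed.

Lemma borelC_preimage (F : R[i] -> R[i]) D : borelC D ->
  (forall U, open (U : set R[i]^o) -> borelC (D `&` F @^-1` U)) ->
  forall B, borelC B -> borelC (D `&` F @^-1` B).
Proof.
move=> hD hF; suff : @borelC R `<=` [set B | borelC (D `&` F @^-1` B)] by apply.
apply: smallest_sub => [|U]; last exact: hF.
split => /=.
- by rewrite preimage_set0 setI0; exact: borelC0.
- move=> B hB; rewrite setTD preimage_setC -setDE.
  have -> : D `\` F @^-1` B = D `\` (D `&` F @^-1` B) by rewrite setDIr setDv set0U.
  exact: borelCD.
- move=> G hG; rewrite preimage_bigcup setI_bigcupr; exact: borelC_bigcup.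
Qed.

Lemma nrm_openC U : open (U : set R[i]^o) <->
  (forall z, U z -> exists2 e : R, 0 < e & forall w, nrm (w - z) < e -> U w).
Proof. exact: (@nrm_openP R (R[i]^o)). Qed.

Lemma open_disc (c : R[i]) (r : R) : open ([set z | nrm (z - c) < r] : set R[i]^o).
Proof.
apply/nrm_openC => z /= zr; exists (r - nrm (z - c)); first by rewrite subr_gt0.
by move=> w; rewrite ltrBrDr; apply: le_lt_trans; exact: nrm_sub_le.
Qed.

Lemma closed_disc (r : R) : closed ([set z : R[i] | `|z| <= r%:C%C] : set R[i]^o).
Proof.
rewrite -openC; apply/nrm_openC => z /=; rewrite -nrm_leE => /negP; rewrite -ltNge.
move=> zr; exists (nrm z - r); first by rewrite subr_gt0.
move=> w wz; rewrite -nrm_leE; apply/negP; rewrite -ltNge.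
rewrite -(ltrD2r (nrm (w - z))).
apply: (@lt_le_trans _ _ (nrm z)); first by rewrite addrC -ltrBrDr.
by rewrite -{1}[z](subKr w) nrmB.
Qed.

Lemma open_box (a b e : R) :
  open ([set z | `|complex.Re z - a| < e /\ `|complex.Im z - b| < e] : set R[i]^o).
Proof.
apply/nrm_openC => z /= [za zb].
exists (Num.min (e - `|complex.Re z - a|) (e - `|complex.Im z - b|)).
  by rewrite lt_min !subr_gt0 za.
move=> w; rewrite lt_min => /andP[wa wb]; split.
  rewrite -(subrKA (complex.Re z)) (le_lt_trans (ler_normD _ _)) // -ltrBrDr.
  apply: le_lt_trans wa; apply: le_trans (nrm_Re _).
  by rewrite raddfB.
rewrite -(subrKA (complex.Im z)) (le_lt_trans (ler_normD _ _)) // -ltrBrDr.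
apply: le_lt_trans wb; apply: le_trans (nrm_Im _).
by rewrite raddfB.
Qed.

End borel_sets.

Section spectral_measures.
Context {R : realType} {X : completeNormedModType R[i]}.
Variables (E : set R[i] -> {linear X -> X}) (hE : spectral_measure E).
Implicit Types (A B : set R[i]) (f : X).

Lemma spm_setU A B f : borelC A -> borelC B -> A `&` B = set0 ->
  E (A `|` B) f = E A f + E B f.
Proof.
move=> hA hB AB.
have tr : trivIset setT (bigcup2 A B).
  apply/trivIsetP => -[|[|i]] [|[|j]] //= _ _ _; rewrite ?set0I ?setI0 //.
  by rewrite setIC.
have mb n : borelC (bigcup2 A B n).
  by case: n => [|[|n]] //=; exact: borelC0.
have := @spm_sigma_additive _ _ _ hE _ mb tr f; rewrite bigcup2E => h.
apply: (nrm_cvg_unique h).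
apply: cvg_near_cst.
exists 2%N => // n /= n2; rewrite -(subnKC n2) big_nat_recl // big_nat_recl //=.
by rewrite big1 ?addr0 // => k _; rewrite (spm_set0 hE).
Qed.

Lemma spm_setD A B f : borelC A -> borelC B -> B `<=` A ->
  E (A `\` B) f = E A f - E B f.
Proof.
move=> hA hB BA; apply/eqP; rewrite eq_sym subr_eq -spm_setU //.
- by rewrite setDKU.
- exact: borelCD.
- by rewrite setDKI.
Qed.

Lemma spm_setC A f : borelC A -> E (~` A) f = f - E A f.
Proof. by move=> hA; rewrite -setTD spm_setD ?(spm_setT hE) //; exact: borelCT. Qed.

(** The disjoint pieces are subsets of the [F n], and by multiplicativity a subset of a set that is
    null at [f] is null at [f]. *)
Lemma spm_bigcup_null (F : nat -> set R[i]) f : (forall n, borelC (F n)) ->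
  (forall n, E (F n) f = 0) -> E (\bigcup_n F n) f = 0.
Proof.
move=> mF nF.
have mS n : borelC (\big[setU/set0]_(i < n) F i).
  elim: n => [|n IH]; first by rewrite big_ord0; exact: borelC0.
  by rewrite big_ord_recr; exact: borelCU.
have mD n : borelC (seqDU F n) by rewrite /seqDU; exact: borelCD.
have := @spm_sigma_additive _ _ _ hE _ mD (trivIset_seqDU _) f.
rewrite -seqDU_bigcup_eq => h.
apply: (nrm_cvg_unique h).
apply: cvg_near_cst; apply: nearW => n.
rewrite big1 // => k _.
have -> : seqDU F k = seqDU F k `&` F k by apply/esym/setIidl; exact: subDsetl.
by rewrite (spm_setI hE) // nF linear0.
Qed.

Lemma spm_nondecreasing_cvg (F : nat -> set R[i]) f : (forall n, borelC (F n)) ->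
  (forall n, F n `<=` F n.+1) -> E (F n) f @[n --> \oo] --> E (\bigcup_n F n) f.
Proof.
move=> mF iF.
have iF' m n : (m <= n)%N -> F m `<=` F n.
  by move=> /subnKC <-; elim: (n - m)%N => [|k IH]; rewrite ?addn0 // addnS; apply: subset_trans IH _.
have mD n : borelC (seqD F n) by case: n => [|n] //=; exact: borelCD.
have hF : {homo F : n m / (n <= m)%N >-> (n <= m)%O}.
  by move=> m n mn; apply/subsetPset/iF'.
have := @spm_sigma_additive _ _ _ hE _ mD (trivIset_seqD hF) f.
rewrite eq_bigcup_seqD -cvg_shiftS.
apply: eq_cvg_to => n /=; elim: n => [|n IH]; first by rewrite big_nat1.
by rewrite big_nat_recr //= IH spm_setD // addrC subrK.
Qed.

(* If a set carries unboundedly many values then so does one of the two halves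
   of a suitable splitting, the other half having large measure; iterating
   yields disjoint sets of large measure, against countable additivity. *)
Lemma spm_bounded_orbit f : exists C : R, forall A, borelC A -> nrm (E A f) <= C.
Proof.
apply: contrapT => nb.
pose unb A := borelC A /\ forall C : R, exists D, [/\ borelC D, D `<=` A & C < nrm (E D f)].
have unbT : unb setT.
  split; first exact: borelCT.
  move=> C; apply: contrapT => nD; apply: nb; exists C => A hA.
  by rewrite leNgt; apply/negP => CA; apply: nD; exists A; split.
have split_unb (nB : nat * set R[i]) : exists B',
    unb nB.2 -> [/\ unb B', B' `<=` nB.2 & nB.1%:R < nrm (E (nB.2 `\` B') f)].
  case: nB => n B /=; have [uB|] := pselect (unb B); last by exists B.
  (* The margin [nrm (E B f)] makes both [D] and its complement in [B] carry more than [n], so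
     either of them can be discarded. *)
  have [mB /(_ (n%:R + nrm (E B f)))[D [mD DB hD]]] := uB.
  have mBD : borelC (B `\` D) by exact: borelCD.
  have hBD : n%:R < nrm (E (B `\` D) f).
    rewrite spm_setD //; have := nrmB (E B f) (E B f - E D f); rewrite subKr; lra.
  have [uD|nuD] := pselect (unb D); first by exists D.
  exists (B `\` D) => _; split => //; last first.
    rewrite setDD (setIidr DB); apply: le_lt_trans hD; by rewrite lerDl nrm_ge0.
  split => // C; apply: contrapT => nC; apply: nuD; split => // C'.
  have [W [mW WB hW]] := uB.2 (C + C').
  exists (W `&` D); split => //; first exact: borelCI.
  rewrite ltNge; apply/negP => hC'.
  have hC : nrm (E (W `\` D) f) <= C.
    rewrite leNgt; apply/negP => CW; apply: nC; exists (W `\` D); split => //.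
      exact: borelCD.
    by move=> z [Wz Dz]; split=> //; exact: WB.
  have : E W f = E (W `\` D) f + E (W `&` D) f.
    rewrite -spm_setU ?setUIDK //; [|exact: borelCD|exact: borelCI|].
      by rewrite setUC setUIDK.
    by rewrite setDE setIACA setICl setI0.
  move=> WE; move: hW; rewrite WE => /lt_le_trans /(_ (nrmD _ _)); lra.
have [g hg] := choice split_unb.
pose s := fix s n := if n is n'.+1 then g (n', s n') else setT.
have us n : unb (s n) by elim: n => //= n IH; have [] := hg (n, s n) IH.
have sS n : s n.+1 `<=` s n by have [] := hg (n, s n) (us n).
have sM n : n%:R < nrm (E (s n `\` s n.+1) f) by have [] := hg (n, s n) (us n).
have sle m n : (m <= n)%N -> s n `<=` s m.
  by move=> /subnKC <-; elim: (n - m)%N => [|k IH]; rewrite ?addn0 // addnS; apply: subset_trans IH.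
have tr : trivIset setT (fun n => s n `\` s n.+1).
  apply: ltn_trivIset => m n mn; rewrite -subset0 => z [[_ nz] [sz _]].
  by apply: nz; exact: (sle _ _ mn).
have md n : borelC (s n `\` s n.+1) by apply: borelCD; [case: (us n)|case: (us n.+1)].
have [C hC] := nrm_cvg_bounded (@spm_sigma_additive _ _ _ hE _ md tr f).
have := sM (Num.truncn (C + C)).+1; set n := (_).+1; rewrite ltNge => /negP; apply.
have -> : E (s n `\` s n.+1) f = \sum_(0 <= k < n.+1) E (s k `\` s k.+1) f
   - \sum_(0 <= k < n) E (s k `\` s k.+1) f by rewrite big_nat_recr //= addrAC subrr add0r.
rewrite (le_trans (nrmB _ _)) // (le_trans (lerD (hC _) (hC _))) //.
by rewrite ltW // truncnS_gt.
Qed.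

Lemma spm_uniformly_bounded :
  exists2 M : R, 0 < M & forall A f, borelC A -> nrm (E A f) <= M * nrm f.
Proof.
have [f|M hM] := @uniform_boundedness R X {A : set R[i] | borelC A} (fun p => E (proj1_sig p))
    (fun p => spm_bounded hE (proj2_sig p)).
  by have [C hC] := spm_bounded_orbit f; exists C => -[A mA]; exact: hC.
exists (`|M| + 1) => [|A f mA]; first by rewrite ltr_wpDl.
rewrite (le_trans (hM (exist (@borelC R) A mA) f)) // ler_wpM2r ?nrm_ge0 //.
by rewrite (le_trans (ler_norm _)) // lerDl.
Qed.

Lemma spm_support_closed : closed (spm_support E : set R[i]^o).
Proof.
rewrite -openC; apply/nrm_openC => z /=.
move=> /existsNP[U /not_implyP[oU /not_implyP[Uz /contrapT EU]]].
have [e e0 he] := (nrm_openC U).1 oU z Uz.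
by exists e => // w wz h; exact: (h U oU (he _ wz)).
Qed.

Lemma spm_support_borel : borelC (spm_support E).
Proof. exact: borelC_closed spm_support_closed. Qed.

(** The complement is a union of open null sets, but only countable unions are controlled. Boxes
    with rational centres form a countable base; [W] enumerates the null ones, with the empty set in
    place of the others. *)
Lemma spm_setC_support f : E (~` spm_support E) f = 0.
Proof.
pose box (i : rat * rat * nat) := [set z : R[i] |
  `|complex.Re z - ratr i.1.1| < i.2.+1%:R^-1 /\
  `|complex.Im z - ratr i.1.2| < i.2.+1%:R^-1].
pose W n := if unpickle n is Some i then
  (if `[< forall f, E (box i) f = 0 >] then box i else set0) else set0.
have mbox i : borelC (box i) by apply: borelC_open; exact: open_box.
have mW n : borelC (W n).
  by rewrite /W; case: unpickle => [i|]; [case: ifP => _ //|]; exact: borelC0.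
have nW n : E (W n) f = 0.
  rewrite /W; case: unpickle => [i|]; last exact: (spm_set0 hE).
  by case: asboolP => [|_]; [apply|exact: (spm_set0 hE)].
suff -> : ~` spm_support E = \bigcup_n W n by exact: spm_bigcup_null.
apply/seteqP; split=> z /=.
  move=> /existsNP[U /not_implyP[oU /not_implyP[Uz /contrapT EU]]].
  have [e e0 he] := (nrm_openC U).1 oU z Uz.
  (* Two points of a box of half side [d] differ by less than [2 d] in each coordinate, hence by
     less than [4 d] in modulus. *)
  pose n := Num.truncn (4 / e).
  have ne : n.+1%:R^-1 < e / 4 :> R.
    by rewrite -[e / 4]invrK ltf_pV2 ?posrE ?invr_gt0 ?divr_gt0 // invf_div truncnS_gt.
  have n0 : 0 < n.+1%:R^-1 :> R by rewrite invr_gt0.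
  have approx (x : R) : exists q : rat, `|x - ratr q| < n.+1%:R^-1.
    have [|q] := @rat_in_itvoo _ (x - n.+1%:R^-1) x; first by rewrite gtrBl.
    rewrite in_itv /= => /andP[q1 q2]; exists q.
    by rewrite ger0_norm ?subr_ge0 ?(ltW q2) // ltrBlDr -ltrBlDl.
  have [p hp] := approx (complex.Re z); have [q hq] := approx (complex.Im z).
  have [k hk] : exists k, unpickle k = Some (p, q, n).
    by exists (pickle (p, q, n)); exact: pickleK.
  exists k; first exact: Logic.I.
  rewrite /W hk; case: asboolP => [_|]; first by split.
  case=> g; have -> : box (p, q, n) = box (p, q, n) `&` U.
    apply/esym/setIidl => w [/= wp wq]; apply: he.
    apply: le_lt_trans (nrm_ReIm _) _; rewrite !raddfB /=.
    have := ler_distD (ratr p) (complex.Re w) (complex.Re z).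
    have := ler_distD (ratr q) (complex.Im w) (complex.Im z).
    rewrite [`|ratr p - _|]distrC [`|ratr q - _|]distrC.
    move: ne wp wq hp hq => /=; move: (_.+1%:R^-1) => d.
    lra.
  by rewrite (spm_setI hE) ?EU ?linear0 //; exact: borelC_open.
move=> [n _]; rewrite /W; case: unpickle => // i.
case: asboolP => // nb bz; move=> /(_ (box i)); apply; last by [].
  exact: open_box.
by [].
Qed.

Lemma spm_support_full f : E (spm_support E) f = f.
Proof.
have := spm_setC f spm_support_borel; rewrite spm_setC_support => /eqP.
by rewrite eq_sym subr_eq0 => /eqP.
Qed.

End spectral_measures.

(** * Bounded functional calculus *)

Section step_functions.
Context {R : realType} {X : completeNormedModType R[i]}.
Variables (E : set R[i] -> {linear X -> X}) (hE : spectral_measure E).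
Implicit Types (A B D : set R[i]) (f : X) (L : seq (R[i] * set R[i])).

Let C (x : R) : R[i] := (x%:C)%C.

(** Refining a list of Borel sets into disjoint atoms, one set at a time, keeps
    the sum in the convex hull of the vectors [r *: (E W f - E (B `\` W) f)]. *)
Let convex_bound (L : seq (R * set R[i])) (r M : R) f :
  (forall p, p \in L -> borelC p.2) -> forall (c : R) B (y : X), borelC B ->
  (forall z, B z -> `|c + \sum_(p <- L) p.1 * \1_(p.2) z| <= r) ->
  (forall W, borelC W -> W `<=` B ->
     nrm (C r *: (E W f - E (B `\` W) f) + y) <= M) ->
  nrm (C c *: E B f + \sum_(p <- L) C p.1 *: E (p.2 `&` B) f + y) <= M.
Proof.
elim: L => [|[c1 A] L IH] mL c B y mB cB hy.
  rewrite big_nil addr0.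
  have hp := hy B mB (@subset_refl _ B); have hm := hy set0 borelC0 (@sub0set _ B).
  rewrite setDv (spm_set0 hE) subr0 in hp.
  rewrite setD0 (spm_set0 hE) sub0r scalerN in hm.
  (* On an empty [B] nothing bounds [c], but then [E B f = 0]. *)
  have [[z Bz]|/nonemptyPn B0] := pselect (B !=set0); last first.
    by move: hp; rewrite B0 (spm_set0 hE) !scaler0.
  have := cB z Bz; rewrite big_nil addr0 ler_norml => /andP[c_ge c_le].
  have [r0|r_gt0] := eqVneq r 0.
    have c0 : c = 0 by apply/eqP; rewrite eq_le; move: c_ge c_le; rewrite r0 oppr0 => -> ->.
    by rewrite c0 -r0.
  have {}r_gt0 : 0 < r.
    by rewrite lt_def r_gt0 /=; move: c_ge c_le; lra.
  (* As [c] lies between [- r] and [r], it is the convex combination [t r + (1 - t) (- r)]; the two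
     ends are the cases [W = B] and [W = set0] of the hypothesis. *)
  pose t := (r + c) / (r + r).
  have t0 : 0 <= t by rewrite divr_ge0 //; move: c_ge c_le; lra.
  have t1 : 0 <= 1 - t.
    by rewrite subr_ge0 ler_pdivrMr; move: c_ge c_le r_gt0; lra.
  have -> : C c *: E B f + y
      = C t *: (C r *: E B f + y) + C (1 - t) *: (- (C r *: E B f) + y).
    rewrite !scalerDr scalerN !scalerA addrACA -scalerDl -scalerBl.
    rewrite /C -!rmorphM -rmorphB -rmorphD /= addrC [t + _]addrC subrK scale1r addrC.
    congr (_%:C%C *: _ + _).
    have : t * (r + r) = r + c by rewrite divfK // lt0r_neq0 // addr_gt0.
    lra.
  rewrite (le_trans (nrmD _ _)) // !nrmZ !nrmC !ger0_norm //.
  have -> : M = t * M + (1 - t) * M by ring.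
  by rewrite lerD // ler_wpM2l.
have mA : borelC A by apply: (mL (c1, A)); rewrite mem_head.
have {}mL p : p \in L -> borelC p.2 by move=> pL; apply: mL; rewrite in_cons pL orbT.
have mB1 : borelC (B `&` A) by exact: borelCI.
have mB2 : borelC (B `\` A) by exact: borelCD.
have split_E W : borelC W -> E W f = E (W `&` A) f + E (W `\` A) f.
  move=> mW; rewrite -spm_setU ?setUIDK //; [exact: borelCI|exact: borelCD|].
  by rewrite setDE setIACA setICr setI0.
have := IH mL (c + c1) (B `&` A)
  (C c *: E (B `\` A) f + \sum_(p <- L) C p.1 *: E (p.2 `&` (B `\` A)) f + y) mB1.
rewrite big_cons /= => IH1; have {IH1} := IH1 _ _; have -> :
  C (c + c1) *: E (B `&` A) f + \sum_(p <- L) C p.1 *: E (p.2 `&` (B `&` A)) f +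
  (C c *: E (B `\` A) f + \sum_(p <- L) C p.1 *: E (p.2 `&` (B `\` A)) f + y) =
  C c *: E B f + (C c1 *: E (A `&` B) f + \sum_(p <- L) C p.1 *: E (p.2 `&` B) f) + y.
  rewrite (split_E B) // scalerDr [A `&` B]setIC /C rmorphD /= scalerDl.
  have -> : \sum_(p <- L) (p.1)%:C%C *: E (p.2 `&` B) f =
     \sum_(p <- L) (p.1)%:C%C *: E (p.2 `&` (B `&` A)) f
     + \sum_(p <- L) (p.1)%:C%C *: E (p.2 `&` (B `\` A)) f.
    rewrite -big_split /= !big_seq; apply: eq_bigr => p pL.
    rewrite (split_E (p.2 `&` B)); last by apply: borelCI => //; exact: mL.
    by rewrite scalerDr -setIA setIDA.
  rewrite -!addrA; congr (_ + _); rewrite [RHS]addrCA; congr (_ + _).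
  by rewrite [RHS]addrCA.
apply => [z [Bz Az]|W mW WB].
  have := cB z Bz; rewrite big_cons /= indicE mem_set // mulr1 addrA; exact.
rewrite addrCA.
apply: IH => // [z [Bz Az]|W' mW' WB'].
  have := cB z Bz; rewrite big_cons /= indicE memNset // mulr0 add0r; exact.
have WWB : W `|` W' `<=` B by move=> z [/WB[]|/WB' []].
have := hy (W `|` W') (borelCU mW mW') WWB.
have -> : B `\` (W `|` W') = (B `&` A `\` W) `|` ((B `\` A) `\` W').
  apply/seteqP; split => z.
    move=> [Bz /not_orP[Wz W'z]]; have [Az|Az] := pselect (A z); by [left|right].
  move=> [[[Bz Az] Wz]|[[Bz Az] Wz]]; split => //; case => //.
    by move=> /WB' [].
  by move=> /WB [].
rewrite !spm_setU //.
- by rewrite opprD addrACA scalerDr [X in nrm (X + y)]addrC -addrA.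
- exact: borelCD.
- exact: borelCD.
- by rewrite -subset0 => z [[[_ Az] _] [[_ nAz] _]].
- by rewrite -subset0 => z [/WB[_ Az] /WB'[_ nAz]].
Qed.

(** A list encodes a formal linear combination of sets; the sets need not be
    disjoint. *)
Definition step_borel L := forall p, p \in L -> borelC p.2.
Definition step_fun L (z : R[i]) : R[i] := \sum_(p <- L) p.1 * \1_(p.2) z.
Definition step_int L f := \sum_(p <- L) p.1 *: E p.2 f.

Lemma step_int_bound : exists2 K : R, 0 < K & forall L (r : R) f,
  step_borel L -> (forall z, nrm (step_fun L z) <= r) ->
  nrm (step_int L f) <= K * r * nrm f.
Proof.
have [M M0 hM] := spm_uniformly_bounded hE.
exists (2 * (2 * M)) => [|L r f mL hL]; first by rewrite !mulr_gt0.
have r0 : 0 <= r by apply: le_trans (nrm_ge0 _) (hL 0).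
have bd (g : R[i] -> R) : (forall z, `|\sum_(p <- L) g p.1 * \1_(p.2) z| <= r) ->
    nrm (\sum_(p <- L) C (g p.1) *: E p.2 f) <= r * (2 * M * nrm f).
  move=> hg.
  have := @convex_bound [seq (g p.1, p.2) | p <- L] r (r * (2 * M * nrm f)) f
     _ 0 setT 0 borelCT.
  rewrite big_map scale0r add0r addr0.
  under eq_bigr do rewrite setIT.
  apply=> [p /mapP[q qL ->]|z _|W mW _] /=; first exact: mL.
    by rewrite big_map add0r.
  rewrite addr0 setTD nrmZ nrmC ger0_norm // ler_wpM2l // (le_trans (nrmB _ _)) //.
  have := hM _ f mW; have := hM _ f (borelCC mW); lra.
have -> : step_int L f = \sum_(p <- L) C (complex.Re p.1) *: E p.2 f
    + ('i)%C *: \sum_(p <- L) C (complex.Im p.1) *: E p.2 f.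
  rewrite scaler_sumr -big_split /=; apply: eq_bigr => p _.
  by rewrite scalerA -scalerDl -complexE.
have i1 : nrm (('i)%C : R[i]) = 1.
  by rewrite /nrm normc_def /= expr0n expr1n add0r sqrtr1.
rewrite (le_trans (nrmD _ _)) // nrmZ i1 mul1r.
have -> : 2 * (2 * M) * r * nrm f = r * (2 * M * nrm f) + r * (2 * M * nrm f) by ring.
rewrite lerD // bd // => z; apply: le_trans (hL z).
- apply: le_trans (nrm_Re _); rewrite /step_fun raddf_sum le_eqVlt; apply/orP; left.
  apply/eqP; congr (`|_|); apply: eq_bigr => p _.
  by rewrite !indicE; case: (z \in p.2); rewrite ?mulr1 ?mulr0.
- apply: le_trans (nrm_Im _); rewrite /step_fun raddf_sum le_eqVlt; apply/orP; left.
  apply/eqP; congr (`|_|); apply: eq_bigr => p _.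
  by rewrite !indicE; case: (z \in p.2); rewrite ?mulr1 ?mulr0.
Qed.

Lemma step_fun_cat L L' z : step_fun (L ++ L') z = step_fun L z + step_fun L' z.
Proof. exact: big_cat. Qed.

Lemma step_int_cat L L' f : step_int (L ++ L') f = step_int L f + step_int L' f.
Proof. exact: big_cat. Qed.

Lemma step_borel_cat L L' : step_borel L -> step_borel L' -> step_borel (L ++ L').
Proof. by move=> mL mL' p; rewrite mem_cat => /orP[/mL|/mL']. Qed.

Definition step_scale (c : R[i]) L := [seq (c * p.1, p.2) | p <- L].

Lemma step_fun_scale c L z : step_fun (step_scale c L) z = c * step_fun L z.
Proof.
by rewrite /step_fun big_map mulr_sumr; apply: eq_bigr => p _; rewrite mulrA.
Qed.

Lemma step_int_scale c L f : step_int (step_scale c L) f = c *: step_int L f.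
Proof.
by rewrite /step_int big_map scaler_sumr; apply: eq_bigr => p _; rewrite scalerA.
Qed.

Lemma step_borel_scale c L : step_borel L -> step_borel (step_scale c L).
Proof. by move=> mL _ /mapP[p pL ->]; exact: (mL p pL). Qed.

Definition step_mul L L' := [seq (p.1 * q.1, p.2 `&` q.2) | p <- L, q <- L'].

Lemma step_fun_mul L L' z : step_fun (step_mul L L') z = step_fun L z * step_fun L' z.
Proof.
rewrite /step_fun /step_mul big_allpairs_dep mulr_suml; apply: eq_bigr => p _.
rewrite mulr_sumr; apply: eq_bigr => q _.
by rewrite indicI /= mulrACA.
Qed.

Lemma step_int_mul L L' f : step_borel L -> step_borel L' ->
  step_int (step_mul L L') f = step_int L (step_int L' f).
Proof.
move=> mL mL'; rewrite /step_int /step_mul big_allpairs_dep !big_seq.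
apply: eq_bigr => p pL; rewrite linear_sum scaler_sumr !big_seq.
apply: eq_bigr => q qL.
by rewrite linearZ /= scalerA (spm_setI hE (mL p pL) (mL' q qL)).
Qed.

Lemma step_borel_mul L L' : step_borel L -> step_borel L' -> step_borel (step_mul L L').
Proof.
move=> mL mL' r /allpairsP[[p q] /= [pL qL ->]] /=.
by apply: borelCI; [exact: mL pL|exact: mL' qL].
Qed.

Lemma step_int_linear L : linear (step_int L).
Proof.
move=> c f g; rewrite /step_int scaler_sumr -big_split; apply: eq_bigr => p _ /=.
by rewrite linearP scalerDr !scalerA mulrC.
Qed.

End step_functions.

Section bounded_calculus.
Context {R : realType} {X : completeNormedModType R[i]}.
Variables (E : set R[i] -> {linear X -> X}) (hE : spectral_measure E).
Implicit Types (A B D : set R[i]) (F G : R[i] -> R[i]) (f : X).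
Implicit Types L : nat -> seq (R[i] * set R[i]).

Definition approximates F L := (forall n, step_borel (L n)) /\
  forall e : R, 0 < e -> \forall n \near \oo, forall z, nrm (step_fun (L n) z - F z) < e.

(** Bounded Borel functions, as the uniform limits of step functions. *)
Definition step_limit F := exists L, approximates F L.

(** The integral of [F] against [E(.) f]. *)
Definition calc F f : X :=
  xget 0 [set y | exists2 L, approximates F L & step_int E (L n) f @[n --> \oo] --> y].

Lemma step_int_dist : exists2 K : R, 0 < K & forall L L' : seq _, forall (r : R) f,
  step_borel L -> step_borel L' ->
  (forall z, nrm (step_fun L z - step_fun L' z) <= r) ->
  nrm (step_int E L f - step_int E L' f) <= K * r * nrm f.
Proof.
have [K K0 hK] := step_int_bound hE; exists K => // L L' r f mL mL' hL.
have -> : step_int E L f - step_int E L' f = step_int E (L ++ step_scale (-1) L') f.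
  by rewrite step_int_cat step_int_scale scaleN1r.
apply: hK => [|z]; first by apply: step_borel_cat => //; exact: step_borel_scale.
by rewrite step_fun_cat step_fun_scale mulN1r.
Qed.

Lemma approximates_cvg F L f : approximates F L -> cvgn (fun n => step_int E (L n) f).
Proof.
move=> [mL hL]; have [K K0 hK] := step_int_dist.
(* Adding [1] keeps the denominators positive when [f = 0]. *)
have f1 : 0 < nrm f + 1 by rewrite ltr_wpDl // nrm_ge0.
apply: nrm_cauchy => e e0.
have d0 : 0 < e / (K * (nrm f + 1)) / 2 by rewrite !divr_gt0 // mulr_gt0.
have [N _ hN] := hL _ d0; exists N => m n Nm Nn.
have h z : nrm (step_fun (L m) z - step_fun (L n) z) <= e / (K * (nrm f + 1)).
  rewrite (le_trans (nrm_sub_le (F z) _ _)) // [in leRHS](splitr (e / _)) lerD //.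
    by rewrite ltW // hN.
  by rewrite nrmBC ltW // hN.
rewrite (le_lt_trans (hK _ _ _ f (mL m) (mL n) h)) //.
have -> : K * (e / (K * (nrm f + 1))) * nrm f = e * (nrm f / (nrm f + 1)).
  by field; rewrite !gt_eqF.
by rewrite gtr_pMr // ltr_pdivrMr // mul1r ltrDl.
Qed.

Lemma approximates_lim F L L' f (y y' : X) : approximates F L -> approximates F L' ->
  (step_int E (L n) f @[n --> \oo] --> y) ->
  (step_int E (L' n) f @[n --> \oo] --> y') -> y = y'.
Proof.
move=> [mL hL] [mL' hL'] hy hy'; have [K K0 hK] := step_int_dist.
have f1 : 0 < nrm f + 1 by rewrite ltr_wpDl // nrm_ge0.
apply/eqP; rewrite -subr_eq0; apply/eqP; apply: nrm_small0 => e e0.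
have hyy : step_int E (L n) f - step_int E (L' n) f @[n --> \oo] --> y - y'.
  exact: cvgB.
apply: (nrm_cvg_le hyy).
have d0 : 0 < e / (K * (nrm f + 1)) / 2 by rewrite !divr_gt0 // mulr_gt0.
near=> n.
have h z : nrm (step_fun (L n) z - step_fun (L' n) z) <= e / (K * (nrm f + 1)).
  rewrite (le_trans (nrm_sub_le (F z) _ _)) // [in leRHS](splitr (e / _)) lerD //.
    by rewrite ltW //; move: z; near: n; exact: hL.
  by rewrite nrmBC ltW //; move: z; near: n; exact: hL'.
rewrite (le_trans (hK _ _ _ f (mL n) (mL' n) h)) //.
have -> : K * (e / (K * (nrm f + 1))) * nrm f = e * (nrm f / (nrm f + 1)).
  by field; rewrite !gt_eqF.
by rewrite ger_pMr // ler_pdivrMr // mul1r lerDl.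
Unshelve. all: by end_near. Qed.

Lemma calc_cvg F L f : approximates F L -> step_int E (L n) f @[n --> \oo] --> calc F f.
Proof.
move=> aL; have /cvg_ex[/= y hy] := @approximates_cvg F L f aL.
rewrite /calc; case: xgetP => [y' -> [L' aL' hy']|/(_ y)]; last by case; exists L.
by rewrite -(approximates_lim aL aL' hy hy').
Qed.

Lemma calcE F L f (y : X) : approximates F L ->
  (step_int E (L n) f @[n --> \oo] --> y) -> calc F f = y.
Proof. by move=> aL; apply: nrm_cvg_unique; exact: calc_cvg. Qed.

Lemma approximatesD F G L L' : approximates F L -> approximates G L' ->
  approximates (fun z => F z + G z) (fun n => L n ++ L' n).
Proof.
move=> [mL hL] [mL' hL']; split=> [n|e e0]; first exact: step_borel_cat.
have e2 : 0 < e / 2 by rewrite divr_gt0.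
near=> n => z; rewrite step_fun_cat opprD addrACA [e]splitr.
rewrite (le_lt_trans (nrmD _ _)) // ltrD //; move: z; near: n.
  exact: hL. exact: hL'.
Unshelve. all: by end_near. Qed.

Lemma approximatesZ c F L : approximates F L ->
  approximates (fun z => c * F z) (fun n => step_scale c (L n)).
Proof.
move=> [mL hL]; split=> [n|e e0]; first exact: step_borel_scale.
have c1 : 0 < nrm c + 1 by rewrite ltr_wpDl // nrm_ge0.
have d0 : 0 < e / (nrm c + 1) by rewrite divr_gt0.
near=> n => z; rewrite step_fun_scale -mulrBr nrmM.
apply: (@le_lt_trans _ _ ((nrm c) * (e / (nrm c + 1)))).
  by rewrite ler_wpM2l ?nrm_ge0 // ltW //; move: z; near: n; exact: hL.
by rewrite mulrCA gtr_pMr // ltr_pdivrMr // mul1r ltrDl.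
Unshelve. all: by end_near. Qed.

Lemma approximates_bounded F L : approximates F L ->
  exists2 r : R, 0 < r & (forall z, nrm (F z) <= r) /\
    \forall n \near \oo, forall z, nrm (step_fun (L n) z) <= r.
Proof.
move=> [_ hL]; have [N _ hN] := hL 1 ltr01.
pose r := \sum_(p <- L N) nrm p.1.
have r0 : 0 <= r by apply: sumr_ge0 => p _; exact: nrm_ge0.
have hr z : nrm (step_fun (L N) z) <= r.
  rewrite (le_trans (nrm_sum _ _)) // ler_sum // => p _.
  rewrite nrmM indicE; case: (z \in _); rewrite ?nrm1 ?mulr1 // nrm0 mulr0.
  exact: nrm_ge0.
have hF z : nrm (F z) <= r + 1.
  rewrite -[F z](subKr (step_fun (L N) z)) (le_trans (nrmB _ _)) // lerD //.
  by apply: ltW; exact: (hN N (leqnn N)).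
exists (r + 1 + 1); first by rewrite -addrA ltr_wpDl.
split=> [z|]; first by rewrite (le_trans (hF z)) // lerDl.
exists N => // n Nn z.
rewrite -[step_fun _ z](subrK (F z)) addrC (le_trans (nrmD _ _)) // lerD //.
by rewrite ltW // hN.
Qed.

Lemma approximatesM F G L L' : approximates F L -> approximates G L' ->
  approximates (fun z => F z * G z) (fun n => step_mul (L n) (L' n)).
Proof.
move=> aL aL'; have [r r0 [hF _]] := approximates_bounded aL.
have [r' r'0 [hG hG']] := approximates_bounded aL'.
move: aL aL' => [mL hL] [mL' hL']; split=> [n|e e0]; first exact: step_borel_mul.
have d0 : 0 < e / (r' + r) by rewrite divr_gt0 // addr_gt0.
near=> n => z; rewrite step_fun_mul.
have -> : step_fun (L n) z * step_fun (L' n) z - F z * G z =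
  (step_fun (L n) z - F z) * step_fun (L' n) z
  + F z * (step_fun (L' n) z - G z) by ring.
have -> : e = e / (r' + r) * r' + r * (e / (r' + r)).
  by rewrite [r * _]mulrC -mulrDr divfK // gt_eqF // addr_gt0.
rewrite (le_lt_trans (nrmD _ _)) // !nrmM ltr_leD //.
  apply: (@le_lt_trans _ _ (nrm (step_fun (L n) z - F z) * r')).
    by rewrite ler_wpM2l ?nrm_ge0 //; move: z; near: n.
  by rewrite ltr_pM2r //; move: z; near: n; exact: hL.
rewrite ler_pM ?nrm_ge0 // ltW //; move: z; near: n; exact: hL'.
Unshelve. all: by end_near. Qed.

Lemma approximates_ind A : borelC A -> approximates \1_A (fun=> [:: (1, A)]).
Proof.
move=> mA; split=> [_ p|e e0]; first by rewrite inE => /eqP ->.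
by apply: nearW => n z; rewrite /step_fun big_seq1 mul1r subrr nrm0.
Qed.

Lemma step_limitD F G : step_limit F -> step_limit G -> step_limit (fun z => F z + G z).
Proof. by move=> [L aL] [L' aL']; eexists; exact: approximatesD aL aL'. Qed.

Lemma step_limitZ c F : step_limit F -> step_limit (fun z => c * F z).
Proof. by move=> [L aL]; eexists; exact: approximatesZ aL. Qed.

Lemma step_limitM F G : step_limit F -> step_limit G -> step_limit (fun z => F z * G z).
Proof. by move=> [L aL] [L' aL']; eexists; exact: approximatesM aL aL'. Qed.

Lemma step_limit_ind A : borelC A -> step_limit \1_A.
Proof. by move=> mA; eexists; exact: approximates_ind. Qed.

Lemma step_limitB F G : step_limit F -> step_limit G -> step_limit (fun z => F z - G z).
Proof.
move=> uF uG.
rewrite (_ : (fun z => _) = (fun z => F z + -1 * G z)); last first.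
  by apply/funext => z; rewrite mulN1r.
by apply: step_limitD => //; exact: step_limitZ.
Qed.

Lemma calcD F G f : step_limit F -> step_limit G ->
  calc (fun z => F z + G z) f = calc F f + calc G f.
Proof.
move=> [L aL] [L' aL']; apply: (calcE (approximatesD aL aL')).
apply: (eq_cvg_to (u := fun n => step_int E (L n) f + step_int E (L' n) f)).
  by move=> n; rewrite step_int_cat.
by apply: cvgD; exact: calc_cvg.
Qed.

Lemma calcZ c F f : step_limit F -> calc (fun z => c * F z) f = c *: calc F f.
Proof.
move=> [L aL]; apply: (calcE (approximatesZ c aL)).
apply: (eq_cvg_to (u := fun n => c *: step_int E (L n) f)).
  by move=> n; rewrite step_int_scale.
by apply: cvgZr; exact: calc_cvg.
Qed.

Lemma calcB F G f : step_limit F -> step_limit G ->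
  calc (fun z => F z - G z) f = calc F f - calc G f.
Proof.
move=> uF uG.
rewrite (_ : (fun z => _) = (fun z => F z + -1 * G z)); last first.
  by apply/funext => z; rewrite mulN1r.
by rewrite calcD ?calcZ ?scaleN1r //; exact: step_limitZ.
Qed.

Lemma calc_ind A f : borelC A -> calc \1_A f = E A f.
Proof.
move=> mA; apply: (calcE (approximates_ind mA)).
apply: (eq_cvg_to (u := fun=> E A f)); last exact: cvg_cst.
by move=> n; rewrite /step_int big_seq1 scale1r.
Qed.

Lemma calc_linear F : step_limit F -> linear (calc F).
Proof.
move=> [L aL] c f g; apply: (calcE aL).
apply: (eq_cvg_to (u := fun n => c *: step_int E (L n) f + step_int E (L n) g)).
  by move=> n; rewrite step_int_linear.
by apply: cvgD; [apply: cvgZr|]; exact: calc_cvg.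
Qed.

Lemma calc_bound : exists2 K : R, 0 < K & forall F (r : R) f,
  step_limit F -> (forall z, nrm (F z) <= r) -> nrm (calc F f) <= K * r * nrm f.
Proof.
have [K K0 hK] := step_int_bound hE; exists K => // F r f [L aL] hF.
apply/ler_addgt0Pr => e e0.
have f1 : 0 < nrm f + 1 by rewrite ltr_wpDl // nrm_ge0.
have d0 : 0 < e / (K * (nrm f + 1)) by rewrite !divr_gt0 // mulr_gt0.
apply: (nrm_cvg_le (calc_cvg (f := f) aL)); have [mL hL] := aL.
near=> n.
have h z : nrm (step_fun (L n) z) <= r + e / (K * (nrm f + 1)).
  rewrite -[step_fun _ z](subrK (F z)) addrC (le_trans (nrmD _ _)) // lerD //.
  by rewrite ltW //; move: z; near: n; exact: hL.
rewrite (le_trans (hK _ _ f (mL n) h)) // mulrDr mulrDl lerD2l.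
have -> : K * (e / (K * (nrm f + 1))) * nrm f = e * (nrm f / (nrm f + 1)).
  by field; rewrite !gt_eqF.
by rewrite ger_pMr // ler_pdivrMr // mul1r lerDl.
Unshelve. all: by end_near. Qed.

(** For lists the product rule is multiplicativity of [E]. The limit is taken in both factors at
    once, because the operators [step_int E (L n)] are bounded uniformly in [n]. *)
Lemma calcM F G f : step_limit F -> step_limit G ->
  calc (fun z => F z * G z) f = calc F (calc G f).
Proof.
move=> [L aL] [L' aL']; apply: (calcE (approximatesM aL aL')).
have [K K0 hK] := step_int_bound hE.
have [r r0 [_ hr]] := approximates_bounded aL.
have hL := calc_cvg (f := calc G f) aL.
have hL' := calc_cvg (f := f) aL'; have [mL _] := aL; have [mL' _] := aL'.
apply/nrm_cvgP => e e0.
have d0 : 0 < e / 2 / (K * r) by rewrite !divr_gt0 // mulr_gt0.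
have e2 : 0 < e / 2 by rewrite divr_gt0.
have near_L := (nrm_cvgP _ _).1 hL _ e2.
have near_L' := (nrm_cvgP _ _).1 hL' _ d0.
near=> n; rewrite step_int_mul // [e]splitr.
rewrite (le_lt_trans (nrm_sub_le (step_int E (L n) (calc G f)) _ _)) // ltrD //.
  have [S hS] := linear_pack (@step_int_linear _ _ E (L n)).
  rewrite -!hS -linearB hS.
  apply: (@le_lt_trans _ _ (K * r * nrm (step_int E (L' n) f - calc G f))).
    by apply: hK => //; near: n.
  rewrite mulrC -ltr_pdivlMr ?mulr_gt0 //; near: n; exact: near_L'.
near: n; exact: near_L.
Unshelve. all: by end_near. Qed.

End bounded_calculus.

(** * Bounded Borel functions as uniform limits of simple functions *)

Section borel_functions.
Context {R : realType}.
Implicit Types (D : set R[i]) (F : R[i] -> R[i]).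

Definition borel_on D F :=
  forall U : set R[i], open (U : set R[i]^o) -> borelC (D `&` F @^-1` U).

Lemma borelC_halfplane (g : {additive R[i] -> R}) (b : R) :
  (forall z, `|g z| <= nrm z) -> borelC [set z | g z < b].
Proof.
move=> hg; apply: borelC_open; apply/nrm_openC => z /= zb.
exists (b - g z); first by rewrite subr_gt0.
move=> w wz; rewrite -(subrK (g z) (g w)) -ltrBrDr -raddfB.
by apply: le_lt_trans wz; apply: le_trans (hg _); exact: ler_norm.
Qed.

Lemma borelC_strip (g : {additive R[i] -> R}) (a b : R) :
  (forall z, `|g z| <= nrm z) -> borelC [set z | a <= g z < b].
Proof.
move=> hg; have -> : [set z | a <= g z < b] = ~` [set z | g z < a] `&` [set z | g z < b].
  by apply/seteqP; split=> z /=; [move=> /andP[+ ->]|case=> + ->];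
    rewrite ?andbT leNgt => /negP.
by apply: borelCI; [apply: borelCC|]; exact: borelC_halfplane.
Qed.

(** The real and imaginary parts of [F] are rounded down to a grid of mesh [1 / (n + 1)]. The shift
    by [r] makes the arguments of [truncn] nonnegative. *)
Lemma simple_approximation D F (r : R) : borelC D -> borel_on D F ->
  (forall z, D z -> nrm (F z) <= r) ->
  exists2 s : nat -> R[i] -> R[i], (forall n, simple (s n)) &
    forall n z, D z -> nrm (s n z - F z) <= 2 / n.+1%:R.
Proof.
move=> mD mF hF.
pose q (n : nat) (x : R) := Num.truncn ((x + r) * n.+1%:R).
pose v (n j : nat) : R := j%:R / n.+1%:R - r.
pose w n j k : R[i] := Complex (v n j) (v n k).
pose s n z := if z \in D then w n (q n (complex.Re (F z))) (q n (complex.Im (F z))) else 0.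
have n0 n : 0 < n.+1%:R :> R by rewrite ltr0n.
have qitv n x : `|x| <= r -> (q n x)%:R <= (x + r) * n.+1%:R < (q n x).+1%:R.
  rewrite ler_norml => /andP[x1 x2].
  by apply: Num.Theory.truncn_itv; rewrite mulr_ge0 // -[r]opprK subr_ge0.
have hRe z : D z -> `|complex.Re (F z)| <= r by move=> /hF; apply: le_trans; exact: nrm_Re.
have hIm z : D z -> `|complex.Im (F z)| <= r by move=> /hF; apply: le_trans; exact: nrm_Im.
have vq n x : `|x| <= r -> `|v n (q n x) - x| <= n.+1%:R^-1.
  move=> /(qitv n) /andP[h1 h2]; rewrite /v distrC ger0_norm.
    rewrite opprB addrA lerBlDr -[X in _ <= X + _]mul1r -mulrDl ler_pdivlMr //.
    by rewrite [1 + _]addrC natr1 ltW.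
  by rewrite opprB addrA subr_ge0 ler_pdivrMr.
exists s => [n|n z Dz]; last first.
  rewrite /s mem_set // (le_trans (nrm_ReIm _)) // !raddfB /=.
  by rewrite mulr_natl mulr2n lerD // vq //; [exact: hRe|exact: hIm].
split.
  pose N := (Num.truncn ((r + r) * n.+1%:R)).+1.
  have qN x : `|x| <= r -> (q n x < N)%N.
    move=> /ler_normlP[_ xr]; rewrite ltnS; apply: Num.Theory.le_truncn.
    by rewrite ler_pM2r // lerD2r.
  apply: (@sub_finite_set _ _ ([set 0] `|` [set w n p.1 p.2 | p in `I_N `*` `I_N])).
    move=> _ [z _ <-]; rewrite /s; case: ifPn => [/set_mem Dz|_]; last by left.
    right; exists (q n (complex.Re (F z)), q n (complex.Im (F z))) => //.
    by split => /=; apply: qN; [exact: hRe|exact: hIm].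
  rewrite finite_setU; split; first exact: finite_set1.
  by apply: finite_image; apply: finite_setX; exact: finite_II.
move=> c.
pose box j k := [set u : R[i] | j%:R / n.+1%:R - r <= complex.Re u < j.+1%:R / n.+1%:R - r]
  `&` [set u : R[i] | k%:R / n.+1%:R - r <= complex.Im u < k.+1%:R / n.+1%:R - r].
have mbox j k : borelC (box j k).
  by apply: borelCI; [exact: (borelC_strip _ _ (@nrm_Re R))|exact: (borelC_strip _ _ (@nrm_Im R))].
(* A level set is a countable union of preimages of half-open grid cells; the value [0] is also
   taken off [D]. *)
have -> : s n @^-1` [set c] =
   (\bigcup_j \bigcup_k (if w n j k == c then D `&` F @^-1` box j k else set0))
   `|` (if c == 0 then ~` D else set0).
  apply/seteqP; split => z /=.
    rewrite /s; case: ifPn => [/set_mem Dz <-|/negP Dz <-]; last first.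
      by right; rewrite eqxx => /mem_set.
    left; exists (q n (complex.Re (F z))) => //; exists (q n (complex.Im (F z))) => //.
    rewrite eqxx; split => //; split => /=; rewrite lerBlDr ltrBrDr ler_pdivrMr // ltr_pdivlMr //.
      exact/qitv/hRe.
    exact/qitv/hIm.
  move=> [[j _ [k _]]|]; last first.
    by case: eqP => // -> Dz; rewrite /s ifF //; apply/negP => /set_mem.
  case: eqP => // <- [Dz [/=]]; rewrite !lerBlDr !ltrBrDr !ler_pdivrMr // !ltr_pdivlMr //.
  move=> hj hk; rewrite /s mem_set //.
  have qE x l : l%:R <= (x + r) * n.+1%:R < l.+1%:R -> q n x = l.
    by move=> h; rewrite /q; exact: Num.Theory.truncn_def.
  by rewrite (qE _ _ hj) (qE _ _ hk).
apply: borelCU; last by case: ifP => _; [exact: borelCC|exact: borelC0].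
apply: borelC_bigcup => j; apply: borelC_bigcup => k.
case: ifP => _; last exact: borelC0.
exact: borelC_preimage.
Qed.

Lemma nrm_continuous_atP F (z : R[i]) :
  {for z, continuous (F : R[i]^o -> R[i]^o)} <->
  (forall e : R, 0 < e -> exists2 d : R, 0 < d &
     forall w, nrm (w - z) < d -> nrm (F w - F z) < e).
Proof.
have cP := @nrm_cvgP R R[i]^o _ (nbhs (z : R[i]^o)) (nbhs_filter _) F (F z).
split=> [/cP.1 h e /h /nbhs_ballP[d /= d0 hd]|h].
  have dE : d = ((complex.Re d)%:C)%C by rewrite RRe_real // gtr0_real.
  exists (complex.Re d) => [|w wz]; first by rewrite -ltcR -dE.
  by apply: hd; rewrite -ball_normE /= dE -nrm_ltE nrmBC.
apply: cP.2 => e /h[d d0 hd]; apply/nbhs_ballP.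
exists (d%:C)%C; first by rewrite /= ltcR.
by move=> w; rewrite -ball_normE /= -nrm_ltE nrmBC; exact: hd.
Qed.

(** Continuity on an open neighbourhood of [D] suffices, which covers functions with poles off [D],
    such as inverses. *)
Lemma borel_on_continuous (O D : set R[i]) F : open (O : set R[i]^o) ->
  borelC D -> D `<=` O ->
  (forall z, O z -> {for z, continuous (F : R[i]^o -> R[i]^o)}) -> borel_on D F.
Proof.
move=> oO mD DO cF U oU.
have -> : D `&` F @^-1` U = D `&` (O `&` F @^-1` U).
  by rewrite setIA (setIidl DO).
apply: borelCI => //; apply: borelC_open; apply/nrm_openC => z [Oz Uz].
have [e1 e10 h1] := (nrm_openC O).1 oO z Oz.
have [e2 e20 h2] := (nrm_openC U).1 oU _ Uz.
have [d d0 hd] := (nrm_continuous_atP F z).1 (cF z Oz) e2 e20.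
exists (Num.min e1 d); first by rewrite lt_min e10.
by move=> w; rewrite lt_min => /andP[w1 w2]; split; [exact: h1|exact/h2/hd].
Qed.

(** The list runs over the finitely many values of [s]. It is fixed before the space and the
    measure, so that it also serves for [step_limit], which mentions neither. *)
Lemma simple_step D (s : R[i] -> R[i]) : borelC D -> simple s ->
  exists L, [/\ step_borel L, forall z, step_fun L z = s z * \1_D z &
    forall (X : completeNormedModType R[i]) (E : set R[i] -> {linear X -> X}) f,
      step_int E L f = simple_integral E D s f].
Proof.
move=> mD [fs ms].
exists [seq (w, D `&` s @^-1` [set w]) | w <- finmap.enum_fset (fset_set (range s))]; split.
- by move=> _ /mapP[w _ ->] /=; exact: borelCI.
- move=> z; rewrite /step_fun big_map (bigD1_seq (s z)) //=; last exact: finmap.fset_uniq.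
    rewrite big1 ?addr0 => [|w ws].
      by rewrite indicI /= [X in _ * (_ * X)]indicE mem_set // mulr1.
    by rewrite indicI /= [X in _ * (_ * X)]indicE memNset ?mulr0 // => zw; rewrite -zw eqxx in ws.
  by rewrite in_fset_set // inE; exists z.
- by move=> X E f; rewrite /step_int big_map /simple_integral fsbig_finite.
Qed.

Lemma uniform_approximation D F (s : nat -> R[i] -> R[i]) :
  (forall n z, D z -> nrm (s n z - F z) <= 2 / n.+1%:R) ->
  forall e : R, 0 < e -> \forall n \near \oo, forall z, D z -> nrm (s n z - F z) < e.
Proof.
move=> hs e e0; exists (Num.truncn (2 / e)) => // n /= Nn z Dz.
apply: (le_lt_trans (hs _ _ Dz)).
rewrite ltr_pdivrMr ?ltr0n // -ltr_pdivrMl // mulrC.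
by rewrite (lt_le_trans (truncnS_gt _)) // ler_nat ltnS.
Qed.

Lemma step_approximates D F (s : nat -> R[i] -> R[i]) L :
  (forall e : R, 0 < e -> \forall n \near \oo, forall z, D z -> nrm (s n z - F z) < e) ->
  (forall n, [/\ step_borel (L n), forall z, step_fun (L n) z = s n z * \1_D z &
    forall (X : completeNormedModType R[i]) (E : set R[i] -> {linear X -> X}) f,
      step_int E (L n) f = simple_integral E D (s n) f]) ->
  approximates (fun z => F z * \1_D z) L.
Proof.
move=> hs hL; split=> [n|e e0]; first by have [] := hL n.
have := hs e e0; apply: filterS => n h z; have [_ -> _] := hL n.
rewrite -mulrBl nrmM indicE; case: (boolP (z \in D)) => [/set_mem/h|_].
  by rewrite nrm1 mulr1.
by rewrite nrm0 mulr0.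
Qed.

Lemma integral_step_limit D F (r : R) : borelC D -> borel_on D F ->
  (forall z, D z -> nrm (F z) <= r) -> step_limit (fun z => F z * \1_D z).
Proof.
move=> mD mF hF; have [s ms hs] := simple_approximation mD mF hF.
have [L hL] := choice (fun n => simple_step mD (ms n)).
exists L; apply: (step_approximates (s := s)) => //.
exact: uniform_approximation hs.
Qed.

End borel_functions.

Section integral_calculus.
Context {R : realType} {X : completeNormedModType R[i]}.
Variables (E : set R[i] -> {linear X -> X}) (hE : spectral_measure E).
Implicit Types (A B D : set R[i]) (F G : R[i] -> R[i]) (f : X).

(** This ties the integral used in the definition of a scalar type operator to the functional
    calculus: every admissible sequence of simple functions has the limit [calc], and one exists, so
    the default [0] is never taken. *)
Lemma bounded_integralE D F (r : R) f : borelC D -> borel_on D F ->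
  (forall z, D z -> nrm (F z) <= r) ->
  bounded_integral E D F f = calc E (fun z => F z * \1_D z) f.
Proof.
move=> mD mF hF.
have val y : is_bounded_integral E D F f y -> y = calc E (fun z => F z * \1_D z) f.
  move=> [s [ms hs sy]]; have [L hL] := choice (fun n => simple_step mD (ms n)).
  apply/esym/(calcE hE (L := L)).
    apply: (step_approximates (s := s)) => // e e0.
    by have := hs e e0; apply: filterS => n h z /h; rewrite -nrm_ltE.
  by apply: eq_cvg_to sy => n; have [_ _ ->] := hL n.
rewrite /bounded_integral; case: xgetP => [y -> /val //|nval].
have [s ms hs] := simple_approximation mD mF hF.
have [L hL] := choice (fun n => simple_step mD (ms n)).
have hu := uniform_approximation hs.
have aL : approximates (fun z => F z * \1_D z) L by exact: (step_approximates (s := s)).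
exfalso; apply: (nval (calc E (fun z => F z * \1_D z) f)); exists s; split => //.
  move=> e e0; have := hu e e0; apply: filterS => n h z /h.
  by rewrite -nrm_ltE.
have := calc_cvg hE (f := f) aL.
by apply: eq_cvg_to => n; have [_ _ ->] := hL n.
Qed.

End integral_calculus.

(** * The complex exponential *)

Section complex_exponential.
Context {R : realType}.
Implicit Types (z w : R[i]) (x y t h : R).

Lemma lipschitz1_derive (g g' : R -> R) :
  (forall x, is_derive x 1 g (g' x)) -> (forall x, `|g' x| <= 1) ->
  forall x y, `|g x - g y| <= `|x - y|.
Proof.
move=> dg bg; suff H x y : x <= y -> `|g y - g x| <= `|y - x|.
  move=> x y; have [/H|/ltW/H //] := leP x y.
  by rewrite distrC [leRHS]distrC.
move=> xy; have cg : {within `[x, y], continuous g}.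
  apply: derivable_within_continuous => u _; by have [] := dg u.
have [c _ ->] := MVT_segment xy (fun u _ => dg u) cg.
by rewrite normrM ler_piMl.
Qed.

Lemma derive_little_o (g : R -> R) (d : R) : is_derive (0 : R) 1 g d ->
  forall e, 0 < e -> exists2 r, 0 < r &
    forall x, `|x| < r -> `|g x - g 0 - d * x| <= e * `|x|.
Proof.
move=> [dg <-] e e0.
have := dg => /cvgrPdist_lt /(_ e e0) /nbhs_ballP[r /= r0 hr].
exists r => // x xr; have [->|x0] := eqVneq x 0.
  by rewrite mulr0 subr0 subrr !normr0 mulr0.
have := hr x; rewrite /ball /= sub0r normrN => /(_ xr x0) /ltW.
rewrite /= addr0 [x *: 1]mulr1 => H.
have -> : g x - g 0 - 'D_1 g 0 * x = - (('D_1 g 0 - x^-1 * (g x - g 0)) * x) by field.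
by rewrite normrN normrM ler_wpM2r.
Qed.

Definition cexp z : R[i] :=
  Complex (expR (complex.Re z) * cos (complex.Im z)) (expR (complex.Re z) * sin (complex.Im z)).

Definition cis y : R[i] := Complex (cos y) (sin y).

Lemma cexpE z : cexp z = (expR (complex.Re z))%:C%C * cis (complex.Im z).
Proof. by apply/eqP; rewrite eq_complex /= !mul0r subr0 addr0 !eqxx. Qed.

Lemma nrm_cis y : nrm (cis y) = 1.
Proof.
by apply/eqP; rewrite -(@eqrXn2 _ 2) ?nrm_ge0 // nrm_sqr /= cos2Dsin2 expr1n.
Qed.

Lemma nrm_cexp z : nrm (cexp z) = expR (complex.Re z).
Proof. by rewrite cexpE nrmM nrmC nrm_cis mulr1 ger0_norm ?expR_ge0. Qed.

Lemma cexp0 : cexp 0 = 1.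
Proof. by apply/eqP; rewrite eq_complex /= expR0 cos0 sin0 mulr1 mulr0 !eqxx. Qed.

Lemma cexpD z w : cexp (z + w) = cexp z * cexp w.
Proof.
case: z w => [a b] [c d]; apply/eqP; rewrite eq_complex /= expRD cosD sinD.
by apply/andP; split; apply/eqP; ring.
Qed.

Lemma nrm_cis_sub1 y : nrm (cis y - 1) <= 2 * `|y|.
Proof.
apply: le_trans (nrm_ReIm _) _; rewrite !raddfB /= subr0 mulr_natl mulr2n lerD //.
  rewrite -[X in `|_ - X|]cos0 -[X in _ <= `|X|]subr0.
  apply: (lipschitz1_derive (g' := fun u => - sin u)) => u.
  by rewrite normrN sin_max.
rewrite -[sin y]subr0 -[X in `|_ - X|]sin0 -[X in _ <= `|X|]subr0.
by apply: (lipschitz1_derive (g' := cos)) => u; exact: cos_max.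
Qed.

Lemma expR_sub1_le x m : 0 <= m -> x <= m -> `|expR x - 1| <= `|x| * expR m.
Proof.
move=> m0 xm; have m1 : 1 <= expR m by rewrite -expR0 ler_expR.
have [x0|x0] := leP 0 x.
  rewrite !ger0_norm ?subr_ge0 //; last by rewrite -expR0 ler_expR.
  apply: (@le_trans _ _ (x * expR x)); last by rewrite ler_wpM2l // ler_expR.
  have := expR_ge1Dx (- x); have := expRxMexpNx_1 x; have := expR_gt0 x.
  nra.
rewrite ltr0_norm ?subr_lt0 ?expR_lt1 // ltr0_norm // opprB.
have := expR_ge1Dx x; nra.
Qed.

(** Write [exp z - 1 = (exp x - 1) cis y + (cis y - 1)]; the two terms contribute [1] and [2] to the
    constant. Only the real part is bounded, so the estimate applies on a whole half-plane. *)
Lemma nrm_cexp_sub1 z m : 0 <= m -> complex.Re z <= m ->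
  nrm (cexp z - 1) <= 3 * nrm z * expR m.
Proof.
move=> m0 zm; have m1 : 1 <= expR m by rewrite -expR0 ler_expR.
have -> : cexp z - 1 = (expR (complex.Re z) - 1)%:C%C * cis (complex.Im z)
  + (cis (complex.Im z) - 1) by rewrite cexpE rmorphB /=; ring.
rewrite (le_trans (nrmD _ _)) // nrmM nrm_cis mulr1 nrmC.
have := expR_sub1_le m0 zm; have := nrm_cis_sub1 (complex.Im z).
have := nrm_Re z; have := nrm_Im z; have := nrm_ge0 z.
have := normr_ge0 (complex.Im z); have := normr_ge0 (complex.Re z).
move: (nrm (cis _ - 1)) (`|expR _ - 1|) (nrm z) (`|complex.Re z|) (`|complex.Im z|) (expR m) m1.
by move=> {z zm m m0} A B n a b E *; nra.
Qed.

Lemma cexp_little_o (e : R) : 0 < e -> exists2 r : R, 0 < r &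
  forall z, nrm z < r -> nrm (cexp z - 1 - z) <= e * nrm z.
Proof.
move=> e0; have d0 : 0 < e / 5 by rewrite divr_gt0.
have [r1 r10 h1] := derive_little_o (is_derive_expR 0) d0.
have [r2 r20 h2] := derive_little_o (is_derive_sin 0) d0.
have [r3 r30 h3] := derive_little_o (is_derive_cos 0) d0.
exists (Num.min (Num.min r1 r2) (Num.min r3 (e / 5))); first by rewrite !lt_min r10 r20 r30 d0.
move=> z; rewrite !lt_min => /andP[/andP[z1 z2] /andP[z3 z4]].
have {h1} := h1 (complex.Re z) (le_lt_trans (nrm_Re _) z1).
have {h2} := h2 (complex.Im z) (le_lt_trans (nrm_Im _) z2).
have {h3} := h3 (complex.Im z) (le_lt_trans (nrm_Im _) z3).
rewrite expR0 cos0 sin0 oppr0 mul0r !mul1r !subr0 addr0.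
move: (nrm_Re z) (nrm_Im z) (nrm_cis_sub1 (complex.Im z)) (cexpE z) z4 (nrm_ge0 z).
move: (nrm z) => n; case: z {z1 z2 z3} => x y /=.
move=> xn yn cy -> ne n0 h3 h2 h1.
have -> : (expR x)%:C%C * cis y - 1 - Complex x y =
  (expR x - 1 - x)%:C%C * cis y + x%:C%C * (cis y - 1) + (cis y - 1 - Complex 0 y).
  by rewrite !rmorphB /= [Complex x y]complexE [Complex 0 y]complexE /=; ring.
have h4 : nrm (cis y - 1 - Complex 0 y) <= e / 5 * `|y| + e / 5 * `|y|.
  by rewrite (le_trans (nrm_ReIm _)) // !raddfB /= !subr0 lerD.
rewrite (le_trans (nrmD _ _)) // (le_trans (lerD (nrmD _ _) h4)) //.
rewrite !nrmM !nrmC nrm_cis mulr1.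
move: h1 cy xn yn (normr_ge0 x) (normr_ge0 y) (nrm_ge0 (cis y - 1)).
move: (`|expR x - 1 - x|) (nrm (cis y - 1)) (`|x|) (`|y|) => A B a b *.
have : a * B <= 2 * (e / 5) * n.
  apply: (@le_trans _ _ (n * (2 * n))); first by rewrite ler_pM //; lra.
  by rewrite mulrCA -mulrA ler_wpM2l // ler_wpM2r // ltW.
nra.
Qed.

Lemma continuous_cexp : continuous (cexp : R[i]^o -> R[i]^o).
Proof.
move=> z; apply/nrm_continuous_atP => e e0.
pose K := expR (complex.Re z) * (3 * expR 1).
have K0 : 0 < K by rewrite !mulr_gt0 ?expR_gt0.
exists (Num.min 1 (e / K)); first by rewrite lt_min ltr01 divr_gt0.
move=> w; rewrite lt_min => /andP[w1 w2].
have -> : cexp w - cexp z = cexp z * (cexp (w - z) - 1).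
  by rewrite mulrBr mulr1 -cexpD [z + _]addrC subrK.
rewrite nrmM nrm_cexp.
have h : complex.Re (w - z) <= 1.
  by rewrite (le_trans (ler_norm _)) // (le_trans (nrm_Re _)) // ltW.
apply: (@le_lt_trans _ _ (expR (complex.Re z) * (3 * nrm (w - z) * expR 1))).
  by rewrite ler_wpM2l ?expR_ge0 // nrm_cexp_sub1.
have -> : expR (complex.Re z) * (3 * nrm (w - z) * expR 1) = nrm (w - z) * K.
  by rewrite /K; ring.
by rewrite -ltr_pdivlMr.
Qed.

End complex_exponential.

(** * Integrals over Borel sets and dominated convergence *)

Section integrals_over_sets.
Context {R : realType} {X : completeNormedModType R[i]}.
Variables (E : set R[i] -> {linear X -> X}) (hE : spectral_measure E).
Implicit Types (A B D : set R[i]) (F G : R[i] -> R[i]) (f : X).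

Definition bounded_borel_on D F := step_limit (fun z => F z * \1_D z).

Definition icalc D F f : X := calc E (fun z => F z * \1_D z) f.

Lemma eq_on_restrict D F G : (forall z, D z -> F z = G z) ->
  (fun z => F z * \1_D z) = (fun z => G z * \1_D z).
Proof.
move=> FG; apply/funext => z; rewrite indicE.
by case: (boolP (z \in D)) => [/set_mem/FG ->|_] //; rewrite !mulr0.
Qed.

Lemma eq_icalc D F G f : (forall z, D z -> F z = G z) -> icalc D F f = icalc D G f.
Proof. by move=> /eq_on_restrict FG; rewrite /icalc FG. Qed.

Lemma eq_bounded_borel_on D F G : (forall z, D z -> F z = G z) ->
  bounded_borel_on D F -> bounded_borel_on D G.
Proof. by move=> /eq_on_restrict FG; rewrite /bounded_borel_on FG. Qed.

Lemma bounded_borel_on_cst D (c : R[i]) : borelC D -> bounded_borel_on D (fun=> c).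
Proof. by move=> mD; apply: step_limitZ; exact: step_limit_ind. Qed.

Lemma icalc_cst D c f : borelC D -> icalc D (fun=> c) f = c *: E D f.
Proof.
by move=> mD; rewrite /icalc calcZ ?(calc_ind hE) //; exact: step_limit_ind.
Qed.

Lemma icalc1 D f : borelC D -> icalc D (fun=> 1) f = E D f.
Proof. by move=> mD; rewrite icalc_cst // scale1r. Qed.

Lemma icalcD D F G f : bounded_borel_on D F -> bounded_borel_on D G ->
  icalc D (fun z => F z + G z) f = icalc D F f + icalc D G f.
Proof.
move=> uF uG; rewrite /icalc -(calcD hE) //; congr calc.
by apply/funext => z; rewrite mulrDl.
Qed.

Lemma bounded_borel_onB D F G : bounded_borel_on D F -> bounded_borel_on D G ->
  bounded_borel_on D (fun z => F z - G z).
Proof.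
move=> uF uG; rewrite /bounded_borel_on.
have -> : (fun z => (F z - G z) * \1_D z) = (fun z => F z * \1_D z - G z * \1_D z).
  by apply/funext => z; rewrite mulrBl.
exact: step_limitB.
Qed.

Lemma icalcB D F G f : bounded_borel_on D F -> bounded_borel_on D G ->
  icalc D (fun z => F z - G z) f = icalc D F f - icalc D G f.
Proof.
move=> uF uG; rewrite /icalc -(calcB hE) //; congr calc.
by apply/funext => z; rewrite mulrBl.
Qed.

Lemma bounded_borel_onZ D c F : bounded_borel_on D F ->
  bounded_borel_on D (fun z => c * F z).
Proof.
move=> uF; rewrite /bounded_borel_on.
have -> : (fun z => (c * F z) * \1_D z) = (fun z => c * (F z * \1_D z)).
  by apply/funext => z; rewrite mulrA.
exact: step_limitZ.
Qed.

Lemma icalcZ D c F f : bounded_borel_on D F ->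
  icalc D (fun z => c * F z) f = c *: icalc D F f.
Proof.
move=> uF; rewrite /icalc -(calcZ hE) //; congr calc.
by apply/funext => z; rewrite mulrA.
Qed.

Let restrictM D D' F G : (fun z => F z * G z * \1_(D `&` D') z) =
  (fun z => (F z * \1_D z) * (G z * \1_D' z)).
Proof. by apply/funext => z; rewrite indicI /= mulrACA. Qed.

Lemma bounded_borel_onM D D' F G : bounded_borel_on D F -> bounded_borel_on D' G ->
  bounded_borel_on (D `&` D') (fun z => F z * G z).
Proof. by move=> uF uG; rewrite /bounded_borel_on restrictM; exact: step_limitM. Qed.

Lemma icalcM D D' F G f : bounded_borel_on D F -> bounded_borel_on D' G ->
  icalc (D `&` D') (fun z => F z * G z) f = icalc D F (icalc D' G f).
Proof. by move=> uF uG; rewrite /icalc restrictM calcM. Qed.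

Lemma bounded_borel_on_setI D A F : borelC A -> bounded_borel_on D F ->
  bounded_borel_on (D `&` A) F.
Proof.
move=> mA uF; have := bounded_borel_onM uF (bounded_borel_on_cst 1 mA).
by apply: eq_bounded_borel_on => z _; rewrite mulr1.
Qed.

Lemma icalc_setIr D A F f : borelC A -> bounded_borel_on D F ->
  icalc (D `&` A) F f = icalc D F (E A f).
Proof.
move=> mA uF; rewrite -(icalc1 f mA) -icalcM //; last exact: bounded_borel_on_cst.
by apply: eq_icalc => z _; rewrite mulr1.
Qed.

Lemma icalc_setIl D A F f : borelC A -> bounded_borel_on D F ->
  icalc (D `&` A) F f = E A (icalc D F f).
Proof.
move=> mA uF; rewrite -(icalc1 (icalc D F f) mA) -icalcM //; last exact: bounded_borel_on_cst.
by rewrite setIC; apply: eq_icalc => z _; rewrite mul1r.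
Qed.

Lemma icalc_linear D F : bounded_borel_on D F -> linear (icalc D F).
Proof. exact: calc_linear. Qed.

Lemma icalc_bound : exists2 K : R, 0 < K & forall D F (r : R) f,
  bounded_borel_on D F -> 0 <= r -> (forall z, D z -> nrm (F z) <= r) ->
  nrm (icalc D F f) <= K * r * nrm f.
Proof.
have [K K0 hK] := calc_bound hE; exists K => // D F r f uF r0 hF; apply: hK => // z.
rewrite nrmM indicE; case: (boolP (z \in D)) => [/set_mem/hF|_].
  by rewrite nrm1 mulr1.
by rewrite nrm0 mulr0.
Qed.

Lemma icalc_pack D F : bounded_borel_on D F ->
  exists L : {linear X -> X}, continuous L /\ forall f, L f = icalc D F f.
Proof.
move=> uF; have [L hL] := linear_pack (icalc_linear uF); exists L; split=> //.
apply/nrm_continuousP; have [K K0 hK] := calc_bound hE.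
have [Ln aL] := uF; have [r r0 [hr _]] := approximates_bounded aL.
by exists (K * r) => f; rewrite hL; exact: hK.
Qed.

Lemma icalcB_vec D F f g : bounded_borel_on D F -> icalc D F (f - g) = icalc D F f - icalc D F g.
Proof. by move=> /icalc_pack[L [_ hL]]; rewrite -!hL linearB. Qed.

Lemma icalc_cvg_vec D F (T : Type) (Fl : set_system T) {FF : Filter Fl} (u : T -> X) (l : X) :
  bounded_borel_on D F -> (u @ Fl --> l) -> icalc D F (u t) @[t --> Fl] --> icalc D F l.
Proof.
move=> /icalc_pack[L [cL hL]] ul; rewrite -hL.
by apply: (eq_cvg_to (u := fun t => L (u t))) => [t|]; [rewrite hL|exact: linear_cvg].
Qed.

Definition disc (n : nat) : set R[i] := [set z | nrm z <= n%:R].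

Lemma disc_normE n : disc n = [set z : R[i] | `|z| <= n%:R].
Proof. by apply/seteqP; split=> z /=; rewrite /disc /= nrm_leE rmorph_nat. Qed.

Lemma borelC_disc n : borelC (disc n).
Proof.
apply: borelC_closed; rewrite disc_normE -(rmorph_nat (real_complex R)).
exact: closed_disc.
Qed.

Lemma spm_disc_cvg f : E (disc n) f @[n --> \oo] --> f.
Proof.
have := spm_nondecreasing_cvg hE (F := disc) (f := f) (fun n => borelC_disc n).
have -> : \bigcup_n disc n = setT.
  apply/seteqP; split => // z _; exists (Num.truncn (nrm z)).+1 => //=.
  by rewrite /disc /= ltW // truncnS_gt.
by rewrite (spm_setT hE); apply => n z /= zn; rewrite /disc /= (le_trans zn) // ler_nat.
Qed.

Lemma icalc_disc_cvg D F f : bounded_borel_on D F ->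
  icalc (D `&` disc n) F f @[n --> \oo] --> icalc D F f.
Proof.
move=> uF; apply: (eq_cvg_to (u := fun n => icalc D F (E (disc n) f))).
  by move=> n; rewrite icalc_setIr //; exact: borelC_disc.
apply: icalc_cvg_vec => //; exact: spm_disc_cvg.
Qed.

(** Uniform convergence is required on each disc only. Since [E (disc N) f] tends to [f], what lies
    outside a large disc acts on a small vector and is controlled by the uniform bound; a limit on
    the disc then does the rest. *)
Lemma icalc_dominated_cvg (T : Type) (Fl : set_system T) {FF : ProperFilter Fl}
    D (G : T -> R[i] -> R[i]) G0 (r : R) f :
  (\forall t \near Fl, bounded_borel_on D (G t)) -> bounded_borel_on D G0 ->
  (\forall t \near Fl, forall z, D z -> nrm (G t z) <= r) ->
  (forall (n : nat) (e : R), 0 < e -> \forall t \near Fl, forall z, D z -> disc n z ->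
     nrm (G t z - G0 z) <= e) ->
  icalc D (G t) f @[t --> Fl] --> icalc D G0 f.
Proof.
move=> uG uG0 hr hG.
have [K K0 hK] := icalc_bound.
have [L0 aL0] := uG0; have [r' r'0 [hr' _]] := approximates_bounded aL0.
have {}hr' z : D z -> nrm (G0 z) <= r'.
  by move=> Dz; have := hr' z; rewrite indicE mem_set // mulr1.
pose M := `|r| + r'; have M0 : 0 < M by rewrite ltr_wpDl.
have f1 : 0 < nrm f + 1 by rewrite ltr_wpDl // nrm_ge0.
apply/nrm_cvgP => e e0.
have e2 : 0 < e / 2 by rewrite divr_gt0.
have d0 : 0 < e / 2 / (K * M) by rewrite !divr_gt0 // mulr_gt0.
have [N _ hN] := (nrm_cvgP _ _).1 (@spm_disc_cvg f) _ d0.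
have {}hN := hN N (leqnn N).
have c0 : 0 < e / 2 / (K * (nrm f + 1)) by rewrite !divr_gt0 // mulr_gt0.
near=> t.
have ut : bounded_borel_on D (G t) by near: t.
have ud : bounded_borel_on D (fun z => G t z - G0 z) by exact: bounded_borel_onB.
have rt z : D z -> nrm (G t z) <= r by move: z; near: t.
have ht z : D z -> disc N z -> nrm (G t z - G0 z) <= e / 2 / (K * (nrm f + 1)).
  by move: z; near: t; exact: hG.
have -> : icalc D (G t) f - icalc D G0 f =
    icalc (D `&` disc N) (fun z => G t z - G0 z) f
    - icalc D (fun z => G t z - G0 z) (E (disc N) f - f).
  rewrite icalc_setIr //; last exact: borelC_disc.
  by rewrite (icalcB_vec _ _ ud) opprB addrCA subrr addr0 icalcB.
rewrite [e]splitr (le_lt_trans (nrmB _ _)) // ler_ltD //.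
  apply: (@le_trans _ _ (K * (e / 2 / (K * (nrm f + 1))) * nrm f)).
    apply: hK; [by apply: bounded_borel_on_setI => //; exact: borelC_disc|exact: ltW|].
    by move=> z [Dz nz]; exact: ht.
  have -> : K * (e / 2 / (K * (nrm f + 1))) * nrm f = e / 2 * (nrm f / (nrm f + 1)).
    by field; rewrite !gt_eqF.
  by rewrite ger_pMr // ler_pdivrMr // mul1r lerDl.
apply: (@le_lt_trans _ _ (K * M * nrm (E (disc N) f - f))).
  apply: hK => //; first exact: ltW.
  move=> z Dz; rewrite (le_trans (nrmB _ _)) // lerD //; last exact: hr'.
  by rewrite (le_trans (rt z Dz)) // ler_norm.
by rewrite mulrC -ltr_pdivlMr ?mulr_gt0.
Unshelve. all: by end_near. Qed.

Lemma bounded_borel_on_continuous (O D : set R[i]) F (r : R) : open (O : set R[i]^o) ->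
  borelC D -> D `<=` O ->
  (forall z, O z -> {for z, continuous (F : R[i]^o -> R[i]^o)}) ->
  (forall z, D z -> nrm (F z) <= r) -> bounded_borel_on D F.
Proof.
move=> oO mD DO cF hF; apply: (@integral_step_limit _ _ _ r) => //.
exact: borel_on_continuous cF.
Qed.

Lemma bounded_integral_icalc D F (r : R) f : borelC D ->
  continuous (F : R[i]^o -> R[i]^o) -> (forall z, D z -> nrm (F z) <= r) ->
  bounded_integral E D F f = icalc D F f.
Proof.
move=> mD cF hF; apply: (bounded_integralE hE (r := r)) => //.
by apply: (@borel_on_continuous _ setT) => // [|z _]; [exact: openT|exact: cF].
Qed.

End integrals_over_sets.

(** * The semigroup generated by a scalar type spectral operator *)

Section exponential_functions.
Context {R : realType}.
Implicit Types (z w : R[i]) (s t h : R).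

Definition cexpt t z : R[i] := cexp (t%:C%C * z).

Lemma nrm_cexpt t z : nrm (cexpt t z) = expR (t * complex.Re z).
Proof. by rewrite nrm_cexp; case: z => a b /=; rewrite mul0r subr0. Qed.

Lemma cexpt0 z : cexpt 0 z = 1.
Proof. by rewrite /cexpt rmorph0 mul0r cexp0. Qed.

Lemma cexptD s t z : cexpt (s + t) z = cexpt s z * cexpt t z.
Proof. by rewrite /cexpt rmorphD mulrDl cexpD. Qed.

Lemma continuous_cexpt t : continuous (cexpt t : R[i]^o -> R[i]^o).
Proof.
move=> z; exact: (@continuous_comp R[i]^o R[i]^o R[i]^o (fun w => t%:C%C * w) cexp z
  (@mulrl_continuous R[i] (t%:C)%C z) (@continuous_cexp R _)).
Qed.

Definition quot h z : R[i] := (h%:C)%C^-1 * (cexpt h z - 1).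

Lemma continuous_quot h : continuous (quot h : R[i]^o -> R[i]^o).
Proof.
move=> z; have c1 : {for z, continuous ((fun w => cexpt h w - 1) : R[i]^o -> R[i]^o)}.
  by apply: continuousB; [exact: continuous_cexpt|exact: cst_continuous].
exact: (@continuous_comp R[i]^o R[i]^o R[i]^o _ (fun w => (h%:C)%C^-1 * w) z c1
  (@mulrl_continuous R[i] _ _)).
Qed.

Lemma nrm_Cinv h : nrm ((h%:C)%C^-1 : R[i]) = `|h|^-1.
Proof. by rewrite nrmV nrmC. Qed.

Lemma C_neq0 h : (h%:C%C != 0 :> R[i]) = (h != 0).
Proof. by rewrite -(inj_eq (@complexI R)). Qed.

(** The error is relative to [nrm z] and governed by the product of [h] and [z] alone, so that it
    survives a division by [z], even near [0]. *)
Lemma quot_little_o (e : R) : 0 < e -> exists2 r : R, 0 < r &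
  forall h z, h != 0 -> `|h| * nrm z < r -> nrm (quot h z - z) <= e * nrm z.
Proof.
move=> e0; have [r r0 hr] := cexp_little_o e0; exists r => // h z h0 hz.
have h0' : 0 < `|h| by rewrite normr_gt0.
have -> : quot h z - z = (h%:C)%C^-1 * (cexpt h z - 1 - (h%:C)%C * z).
  by rewrite /quot [RHS]mulrBr mulKf // C_neq0.
have hzE : nrm ((h%:C)%C * z) = `|h| * nrm z by rewrite nrmM nrmC.
rewrite nrmM nrm_Cinv ler_pdivrMl //.
by rewrite mulrCA -hzE; apply: hr; rewrite hzE.
Qed.

Lemma quot_cvg_disc (n : nat) (e : R) : 0 < e -> exists2 d : R, 0 < d &
  forall h, h != 0 -> `|h| < d -> forall z, disc n z -> nrm (quot h z - z) <= e.
Proof.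
move=> e0; have n0 : 0 < n.+1%:R :> R by rewrite ltr0n.
have [|r r0 hr] := @quot_little_o (e / n.+1%:R); first by rewrite divr_gt0.
exists (r / n.+1%:R); first by rewrite divr_gt0.
move=> h h0 hd z zn.
have zn1 : nrm z <= n.+1%:R by rewrite (le_trans zn) // ler_nat.
apply: (@le_trans _ _ (e / n.+1%:R * nrm z)).
  apply: hr => //; apply: (@le_lt_trans _ _ (`|h| * n.+1%:R)).
    by rewrite ler_wpM2l.
  by rewrite -ltr_pdivlMr.
by rewrite -mulrA ger_pMr // mulrC ler_pdivrMr // mul1r.
Qed.

Lemma nrm_cexpt_sub1 h z m : 0 <= m -> h * complex.Re z <= m ->
  nrm (cexpt h z - 1) <= 3 * (`|h| * nrm z) * expR m.
Proof.
move=> m0 hm; rewrite -nrmC -nrmM; apply: nrm_cexp_sub1 => //.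
by apply: le_trans hm; case: z => a b /=; rewrite mul0r subr0.
Qed.

Lemma nrm_quot h z m : h != 0 -> 0 <= m -> h * complex.Re z <= m ->
  nrm (quot h z) <= 3 * nrm z * expR m.
Proof.
move=> h0 m0 hm; have h0' : 0 < `|h| by rewrite normr_gt0.
rewrite nrmM nrm_Cinv ler_pdivrMl // (le_trans (nrm_cexpt_sub1 m0 hm)) //.
by rewrite le_eqVlt; apply/orP; left; apply/eqP; ring.
Qed.

End exponential_functions.

(** * Generators and spectral integrals through their graphs *)

Section operators_by_limits.
Context {R : realType} {X : completeNormedModType R[i]}.
Implicit Types (A : operator X) (T : R -> {linear X -> X}).

(** Generators and spectral integrals are both defined where a limit exists and by that limit.
    Passing to graphs reduces their comparison to convergence statements. *)
Lemma op_eq_limitP (I : Type) (F : set_system I) {FF : ProperFilter F}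
    (q : X -> I -> X) A :
  op_eq A (Operator [set f | cvg (q f @ F)] (fun f => lim (q f @ F))) <->
  (forall f y, dom A f /\ A f = y <-> (q f @ F --> y)).
Proof.
split=> [[dA vA] f y|H].
  split=> [[Af <-]|hy].
    by rewrite (vA f Af) /=; move: Af; rewrite dA.
  have Af : dom A f by rewrite dA; apply/cvg_ex; exists y.
  by split=> //; rewrite (vA f Af) /=; exact: cvg_lim hy.
have dAq : dom A = [set f | cvg (q f @ F)].
  apply/seteqP; split=> f /= Af.
    by apply/cvg_ex; exists (A f); apply/(H f (A f)).
  by have /cvg_ex[y /H[]] := Af.
split=> // f Af; have /H h : dom A f /\ A f = A f by [].
by apply/esym/cvg_lim.
Qed.

Lemma generator_graph A T : op_eq A (generator T) <->
  (forall f y, dom A f /\ A f = y <->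
     ((h%:C)%C^-1 *: (T h f - f) @[h --> 0^'+] --> y)).
Proof. exact: op_eq_limitP. Qed.

Lemma spectral_graph (E : set R[i] -> {linear X -> X}) D A : spectral_measure E ->
  borelC D -> op_eq A (spectral_integral E D id) <-> (forall f y,
  dom A f /\ A f = y <-> (icalc E (D `&` disc n) id f @[n --> \oo] --> y)).
Proof.
move=> hE mD.
have uE f : (fun n => bounded_integral E (D `&` [set z | `|id z| <= n%:R]) id f) =
    (fun n => icalc E (D `&` disc n) id f).
  apply/funext => n; rewrite -disc_normE.
  apply: (@bounded_integral_icalc _ _ _ hE _ _ n%:R) => [||z [_ //]].
    by apply: borelCI => //; exact: borelC_disc.
  by move=> z; exact: cvg_id.
have -> : spectral_integral E D id =
    Operator [set f | cvgn (fun n => icalc E (D `&` disc n) id f)]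
             (fun f => limn (fun n => icalc E (D `&` disc n) id f)).
  rewrite /spectral_integral; congr Operator; apply/funext => f /=; by rewrite uE.
exact: op_eq_limitP.
Qed.

End operators_by_limits.

Section exponential_semigroup.
Context {R : realType} {X : completeNormedModType R[i]}.
Variables (E : set R[i] -> {linear X -> X}) (hE : spectral_measure E).
Variables (D : set R[i]) (mD : borelC D) (ED : forall f, E D f = f).
Variables (omega : R) (Domega : forall z, D z -> complex.Re z <= omega).
Implicit Types (f g : X) (s t h : R).

(** An upper bound of [t Re z] for all [t] in [[0, 1]], whatever the signs of [omega] and [Re z]. *)
Let m := Num.max 0 omega.
Let m0 : 0 <= m. Proof. by rewrite le_max lexx. Qed.

Let Dm t z : 0 <= t -> t <= 1 -> D z -> t * complex.Re z <= m.
Proof.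
move=> t0 t1 Dz; rewrite /m le_max; have [z0|z0] := leP (complex.Re z) 0.
  by rewrite mulr_ge0_le0.
by apply/orP; right; apply: le_trans (Domega Dz); rewrite ger_pMl.
Qed.

Lemma bounded_borel_on_cexpt t : 0 <= t -> bounded_borel_on D (cexpt t).
Proof.
move=> t0; apply: (@bounded_borel_on_continuous _ setT _ _ (expR (t * omega))) => //.
- exact: openT.
- by move=> z _; exact: continuous_cexpt.
- by move=> z Dz; rewrite nrm_cexpt ler_expR ler_wpM2l // Domega.
Qed.

Lemma bounded_borel_on_quot h : 0 <= h -> bounded_borel_on D (quot h).
Proof.
move=> h0; apply: bounded_borel_onZ; apply: bounded_borel_onB.
  exact: bounded_borel_on_cexpt.
exact: bounded_borel_on_cst.
Qed.

Lemma bounded_borel_on_id_disc n : bounded_borel_on (D `&` disc n) id.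
Proof.
apply: (@bounded_borel_on_continuous _ setT _ _ n%:R) => //.
- exact: openT.
- by apply: borelCI => //; exact: borelC_disc.
- by move=> z _; exact: cvg_id.
- by move=> z [].
Qed.

Lemma icalc_quot h f : 0 <= h ->
  icalc E D (quot h) f = (h%:C)%C^-1 *: (icalc E D (cexpt h) f - f).
Proof.
move=> h0; rewrite icalcZ ?icalcB ?icalc1 ?ED //.
- exact: bounded_borel_on_cexpt.
- exact: bounded_borel_on_cst.
- by apply: bounded_borel_onB; [exact: bounded_borel_on_cexpt|exact: bounded_borel_on_cst].
Qed.

Lemma icalc_cexptD s t f : 0 <= s -> 0 <= t ->
  icalc E D (cexpt (s + t)) f = icalc E D (cexpt s) (icalc E D (cexpt t) f).
Proof.
move=> s0 t0; rewrite -icalcM ?setIid //; try exact: bounded_borel_on_cexpt.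
by apply: eq_icalc => z _; rewrite cexptD.
Qed.

Lemma exponential_C0_semigroup (T : R -> {linear X -> X}) :
  (forall t f, 0 <= t -> T t f = icalc E D (cexpt t) f) -> C0_semigroup T.
Proof.
move=> hT; split.
- move=> t t0; have [L [cL hL]] := icalc_pack hE (bounded_borel_on_cexpt t0).
  by have -> : (T t : X -> X) = L by apply/funext => f; rewrite hT // hL.
- move=> f; rewrite hT // -[RHS]ED -icalc1 //.
  by apply: eq_icalc => z _; rewrite cexpt0.
- by move=> s t s0 t0 f; rewrite !hT ?addr_ge0 // icalc_cexptD.
move=> f; apply: (near_eq_cvg_to (u := fun t => icalc E D (cexpt t) f)).
  near=> t; rewrite hT //; apply: ltW; near: t; exact: nbhs_right_gt.
rewrite -[X in _ --> X]ED -icalc1 //.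
apply: (@icalc_dominated_cvg _ _ _ hE _ _ _ _ _ _ (expR m)).
- near=> t; apply: bounded_borel_on_cexpt; apply: ltW; near: t; exact: nbhs_right_gt.
- exact: bounded_borel_on_cst.
- near=> t.
  have t0 : 0 < t by near: t; exact: nbhs_right_gt.
  have t1 : t <= 1 by near: t; exact: nbhs_right_le.
  by move=> z Dz; rewrite nrm_cexpt ler_expR Dm // ltW.
- move=> n e e0; pose d := e / (3 * n.+1%:R * expR m).
  have n0 : 0 < n.+1%:R :> R by rewrite ltr0n.
  have d0 : 0 < d by rewrite divr_gt0 // !mulr_gt0 ?expR_gt0.
  near=> t.
  have t_gt0 : 0 < t by near: t; exact: nbhs_right_gt.
  have t1 : t <= 1 by near: t; exact: nbhs_right_le.
  have td : t <= d by near: t; exact: nbhs_right_le.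
  move=> z Dz zn; have t0 := ltW t_gt0.
  rewrite (le_trans (nrm_cexpt_sub1 m0 (Dm t0 t1 Dz))) // ger0_norm //.
  apply: (@le_trans _ _ (d * (3 * n.+1%:R * expR m))); last by rewrite divfK // gt_eqF // !mulr_gt0 ?expR_gt0.
  have -> : 3 * (t * nrm z) * expR m = t * (3 * nrm z * expR m) by ring.
  rewrite ler_pM ?mulr_ge0 ?nrm_ge0 ?expR_ge0 // ler_wpM2r ?expR_ge0 // ler_wpM2l //.
  by rewrite (le_trans zn) // ler_nat.
Unshelve. all: by end_near. Qed.

(** As [quot h 0 / 0 = 0], the indicator supplies the limit value [1] at [0]. *)
Let phi h z : R[i] := quot h z / z + \1_[set 0] z.

Let phiE h z : phi h z * z = quot h z.
Proof.
rewrite /phi; have [->|z0] := eqVneq z 0.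
  by rewrite mulr0 /quot /cexpt mulr0 cexp0 subrr mulr0.
by rewrite indicE memNset ?addr0 ?divfK // => z0'; rewrite z0' eqxx in z0.
Qed.

Let phi_sub1 h z c : 0 <= c -> nrm (quot h z - z) <= c * nrm z -> nrm (phi h z - 1) <= c.
Proof.
move=> c0; rewrite /phi; have [->|z0] := eqVneq z 0 => hc.
  by rewrite invr0 mulr0 add0r indicE mem_set // subrr nrm0.
have nz : 0 < nrm z by rewrite lt_def nrm_eq0 z0 nrm_ge0.
rewrite indicE memNset ?addr0; last by move=> z0'; rewrite z0' eqxx in z0.
have -> : quot h z / z - 1 = (quot h z - z) / z by rewrite mulrBl divff.
by rewrite nrmM nrmV ler_pdivrMr.
Qed.

Let nrm_phi h z : 0 < h -> h <= 1 -> D z -> nrm (phi h z) <= 3 * expR m.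
Proof.
move=> h0 h1 Dz; have e1 : 1 <= expR m by rewrite -expR0 ler_expR.
rewrite /phi; have [->|z0] := eqVneq z 0.
  by rewrite invr0 mulr0 add0r indicE mem_set // nrm1; lra.
have nz : 0 < nrm z by rewrite lt_def nrm_eq0 z0 nrm_ge0.
rewrite indicE memNset ?addr0; last by move=> z0'; rewrite z0' eqxx in z0.
have hn0 : h != 0 by rewrite gt_eqF.
rewrite nrmM nrmV ler_pdivrMr // (le_trans (nrm_quot hn0 m0 (Dm (ltW h0) h1 Dz))) //.
by rewrite le_eqVlt; apply/orP; left; apply/eqP; ring.
Qed.

(** The division by [z] is continuous off [0] only, so [D] is split into its part off [0] and its
    part in [[set 0]]. *)
Let bounded_borel_on_phi h : 0 < h -> h <= 1 -> bounded_borel_on D (phi h).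
Proof.
move=> h0 h1.
have m1 : borelC ([set 0] : set R[i]).
  by apply: borelC_closed; apply: accessible_closed_set1; apply: hausdorff_accessible; exact: norm_hausdorff.
have u1 : bounded_borel_on (D `\` [set 0]) (fun z => quot h z / z).
  apply: (@bounded_borel_on_continuous _ [set z | z != 0] _ _ (3 * expR m)).
  - apply/nrm_openC => z /= z0; exists (nrm z); first by rewrite lt_def nrm_eq0 z0 nrm_ge0.
    by move=> w; apply: contraTneq => ->; rewrite sub0r nrmN ltxx.
  - exact: borelCD.
  - by move=> z [_ /= z0]; apply/eqP.
  - move=> z /= z0; have c1 : {for z, continuous ((fun w => w^-1) : R[i]^o -> R[i]^o)}.
      exact: inv_continuous.
    exact: (cvgM (@continuous_quot R h z) c1).
  - move=> z [Dz z0]; have := nrm_phi h0 h1 Dz.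
    by rewrite /phi indicE memNset // addr0.
have u2 : bounded_borel_on (D `&` [set 0]) (fun=> 1).
  by apply: bounded_borel_on_cst; exact: borelCI.
have := step_limitD u1 u2; rewrite /bounded_borel_on.
congr step_limit; apply/funext => z; rewrite mul1r !indicE.
rewrite /phi indicE !in_setI in_setC.
have [Dz|Dz] := boolP (z \in D); rewrite ?mulr0 ?addr0 //= mulr1.
by have [|] := boolP (z \in [set 0]); rewrite ?mulr1 ?mulr0 ?addr0 // => /set_mem ->; rewrite invr0 mulr0.
Qed.

Let disc_eventually (n : nat) (e : R) : 0 < e ->
  \forall h \near 0^'+, forall z : R[i], disc n z -> nrm (quot h z - z) <= e.
Proof.
move=> e0; have [d d0 hd] := @quot_cvg_disc R n e e0.
near=> h; apply: hd.
  by rewrite gt_eqF //; near: h; exact: nbhs_right_gt.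
rewrite gtr0_norm; last by near: h; exact: nbhs_right_gt.
by near: h; exact: nbhs_right_lt.
Unshelve. all: by end_near. Qed.

(** Because [phi h z * z = quot h z] with [phi h] bounded, the difference quotient at [f] equals the
    integral of [phi h] at [y], the value of the operator; and [phi h] tends boundedly to [1]. *)
Let quot_to_value f (y : X) : (icalc E (D `&` disc n) id f @[n --> \oo] --> y) ->
  (icalc E D (quot h) f @[h --> 0^'+] --> y).
Proof.
move=> fy.
apply: (near_eq_cvg_to (u := fun h => icalc E D (phi h) y)).
  near=> h; have h0 : 0 < h by near: h; exact: nbhs_right_gt.
  have h1 : h <= 1 by near: h; exact: nbhs_right_le.
  have up := bounded_borel_on_phi h0 h1.
  have c1 := icalc_cvg_vec hE up fy.
  apply: (nrm_cvg_unique (c1 eventually_filter)).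
  apply: (eq_cvg_to _ (icalc_disc_cvg hE (f := f) (bounded_borel_on_quot (ltW h0)))) => n.
  rewrite -icalcM //; last exact: bounded_borel_on_id_disc.
  by rewrite setIA setIid; apply: eq_icalc => z _; rewrite phiE.
rewrite -[X in _ --> X]ED -icalc1 //.
apply: (@icalc_dominated_cvg _ _ _ hE _ _ _ _ _ _ (3 * expR m)).
- near=> h; apply: bounded_borel_on_phi.
    by near: h; exact: nbhs_right_gt.
  by near: h; exact: nbhs_right_le.
- exact: bounded_borel_on_cst.
- near=> h.
  have h0 : 0 < h by near: h; exact: nbhs_right_gt.
  have h1 : h <= 1 by near: h; exact: nbhs_right_le.
  by move=> z; exact: nrm_phi.
- move=> n e e0; have n0 : 0 < n.+1%:R :> R by rewrite ltr0n.
  have [r r0 hr] := @quot_little_o R e e0.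
  have d0 : 0 < r / n.+1%:R by rewrite divr_gt0.
  near=> h.
  have h0 : 0 < h by near: h; exact: nbhs_right_gt.
  have hr' : h < r / n.+1%:R by near: h; exact: nbhs_right_lt.
  move=> z Dz zn; apply: phi_sub1; first exact: ltW.
  apply: hr; first by rewrite gt_eqF.
  rewrite gtr0_norm //; rewrite ltr_pdivlMr // in hr'; apply: le_lt_trans hr'.
  by rewrite ler_wpM2l ?(ltW h0) // (le_trans zn) // ler_nat.
Unshelve. all: by end_near. Qed.

(** On a disc [quot h] tends uniformly to the identity, so projecting the limit [y] to the disc
    gives the truncated integral of [id] at [f]. The projections of [y] tend to [y]. *)
Let value_of_quot f (y : X) : (icalc E D (quot h) f @[h --> 0^'+] --> y) ->
  (icalc E (D `&` disc n) id f @[n --> \oo] --> y).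
Proof.
move=> fy; apply: (eq_cvg_to _ (spm_disc_cvg hE (f := y))) => n.
have mn : borelC (disc n : set R[i]) by exact: borelC_disc.
have c1 : E (disc n) (icalc E D (quot h) f) @[h --> 0^'+] --> E (disc n) y.
  by apply: linear_cvg fy; exact: (spm_bounded hE).
apply: (nrm_cvg_unique c1).
apply: (near_eq_cvg_to (u := fun h => icalc E (D `&` disc n) (quot h) f)).
  near=> h; rewrite icalc_setIl //; apply: bounded_borel_on_quot.
  by apply: ltW; near: h; exact: nbhs_right_gt.
apply: (@icalc_dominated_cvg _ _ _ hE _ _ _ _ _ _ (n%:R + 1)).
- near=> h; apply: bounded_borel_on_setI => //; apply: bounded_borel_on_quot.
  by apply: ltW; near: h; exact: nbhs_right_gt.
- exact: bounded_borel_on_id_disc.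
- have := disc_eventually n ltr01; apply: filterS => h hn z [Dz zn].
  by rewrite -(subrK z (quot h z)) addrC (le_trans (nrmD _ _)) // lerD // hn.
- by move=> k e e0; have := disc_eventually k e0; apply: filterS => h hk z _ /hk.
Unshelve. all: by end_near. Qed.

Lemma exponential_generates (A : operator X) (T : R -> {linear X -> X}) :
  op_eq A (spectral_integral E D id) ->
  (forall t f, 0 <= t -> T t f = icalc E D (cexpt t) f) -> generates A T.
Proof.
move=> hA hT; split; first exact: exponential_C0_semigroup.
apply/generator_graph => f y; rewrite ((spectral_graph A hE mD).1 hA).
have qE : \forall h \near 0^'+, icalc E D (quot h) f = (h%:C)%C^-1 *: (T h f - f).
  near=> h; have h0 : 0 <= h by apply: ltW; near: h; exact: nbhs_right_gt.
  by rewrite icalc_quot // hT.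
split=> [/quot_to_value|hy]; first exact: near_eq_cvg_to.
apply: value_of_quot; apply: near_eq_cvg_to hy.
by apply: filterS qE => h ->.
Unshelve. all: by end_near. Qed.

Lemma exponential_semigroup_exists : exists T : R -> {linear X -> X},
  forall t f, 0 <= t -> T t f = icalc E D (cexpt t) f.
Proof.
(* The absolute value makes the choice total; negative times are irrelevant. *)
have [T hT] := choice (fun t => icalc_pack hE (bounded_borel_on_cexpt (normr_ge0 t))).
by exists T => t f t0; have [_ ->] := hT t; rewrite ger0_norm.
Qed.

End exponential_semigroup.

(** * Uniqueness of the semigroup *)

Lemma near_at_right0 (R : realType) (P : R -> Prop) :
  (\forall h \near 0^'+, P h) -> exists2 d : R, 0 < d & forall h, 0 < h -> h < d -> P h.
Proof.
move=> H; have /nbhs_ballP[d /= d0 hd] : nbhs (0 : R) (fun h => 0 < h -> P h) by exact: H.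
exists d => // h h0 h_lt; apply: hd => //.
by rewrite /ball /= sub0r normrN gtr0_norm.
Qed.

Lemma near_dnbhs0 (R : realType) (P : R -> Prop) :
  (\forall h \near 0^', P h) -> exists2 d : R, 0 < d & forall h, h != 0 -> `|h| < d -> P h.
Proof.
move=> H; have /nbhs_ballP[d /= d0 hd] : nbhs (0 : R) (fun h => h != 0 -> P h) by exact: H.
exists d => // h h0 h_lt; apply: hd => //.
by rewrite /ball /= sub0r normrN.
Qed.

Section uniform_increments.
Context {R : realType} {X : normedModType R[i]}.

(** A substitute for the fact that a map with zero derivative is constant: since [d] does not depend
    on [s], equal pieces shorter than [d] sum up to an increment of at most [e]. *)
Lemma uniform_increments_constant (v : R -> X) (t : R) : 0 <= t ->
  (forall e, 0 < e -> exists2 d : R, 0 < d & forall s h, 0 < h -> h < d -> 0 <= s ->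
     s + h <= t -> nrm (v (s + h) - v s) <= e * h) -> v t = v 0.
Proof.
move=> t0 hv; have [->//|t_neq0] := eqVneq t 0.
have t_gt0 : 0 < t by rewrite lt_def t_neq0.
apply/eqP; rewrite -subr_eq0; apply/eqP; apply: nrm_small0 => e e0.
have [d d0 hd] := hv (e / t) (divr_gt0 e0 t_gt0).
pose n := (Num.truncn (t / d)).+1; have n0 : 0 < n%:R :> R by rewrite ltr0n.
pose h := t / n%:R; have h0 : 0 < h by rewrite divr_gt0.
have nh : n%:R * h = t by rewrite mulrC divfK // gt_eqF.
have hd' : h < d.
  by rewrite ltr_pdivrMr // mulrC -ltr_pdivrMr // truncnS_gt.
have step k : (k <= n)%N -> nrm (v (k%:R * h) - v 0) <= e / t * (k%:R * h).
  elim: k => [_|k IH kn]; first by rewrite mul0r mulr0 subrr nrm0.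
  have kS : k.+1%:R * h = k%:R * h + h by rewrite -natr1 mulrDl mul1r.
  rewrite kS (le_trans (nrm_sub_le (v (k%:R * h)) _ _)) // mulrDr addrC lerD //.
    by apply: IH; exact: ltnW.
  apply: hd => //; first by rewrite mulr_ge0 // ltW.
  by rewrite -kS -[leRHS]nh ler_wpM2r ?ler_nat // ltW.
by have := step n (leqnn n); rewrite nh divfK.
Qed.

End uniform_increments.

Section C0_semigroups.
Context {R : realType} {X : completeNormedModType R[i]}.
Variables (T : R -> {linear X -> X}) (hT : C0_semigroup T).
Implicit Types (f : X) (s t : R).

(** Otherwise there are times [s n] tending to [0] at which [T (s n)] exceeds [n + 1] in norm,
    whereas strong continuity makes each sequence [T (s n) f] convergent, against uniform
    boundedness. *)
Lemma semigroup_bounded_near0 : exists2 d : R, 0 < d & exists2 M : R, 1 <= M &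
  forall s f, 0 <= s -> s <= d -> nrm (T s f) <= M * nrm f.
Proof.
apply: contrapT => nb.
have bad (n : nat) : exists s, [/\ 0 <= s, s <= n.+1%:R^-1 &
    exists f, n.+1%:R * nrm f < nrm (T s f)].
  apply: contrapT => ns; apply: nb; exists n.+1%:R^-1; first by rewrite invr_gt0.
  exists n.+1%:R => [|s f s0 sn]; first by rewrite ler1n.
  by rewrite leNgt; apply/negP => hf; apply: ns; exists s; split => //; exists f.
have [s hs] := choice bad.
have cvgT f : T (s n) f @[n --> \oo] --> f.
  apply/nrm_cvgP => e e0.
  have /near_at_right0[d d0 hd] : \forall h \near 0^'+, nrm (T h f - f) < e.
    exact: (nrm_cvgP _ _).1 (@sg_continuous _ _ _ hT f) e e0.
  near=> n; have [s0 sn _] := hs n.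
  (* The limit from the right says nothing about the time [0] itself. *)
  have [->|sn0] := eqVneq (s n) 0; first by rewrite (sg_0 hT) subrr nrm0.
  apply: hd; first by rewrite lt_def sn0.
  rewrite (le_lt_trans sn) //.
  by near: n; exact: near_infty_natSinv_lt (PosNum d0).
have [n||C hC] := @uniform_boundedness R X nat (fun n => T (s n)).
- by apply: (sg_bounded hT); have [] := hs n.
- by move=> f; exact: nrm_cvg_bounded (cvgT f).
have [_ _ [f hf]] := hs (Num.truncn C).
move: hf; rewrite ltNge => /negP; apply; rewrite (le_trans (hC _ _)) //.
by rewrite ler_wpM2r ?nrm_ge0 // ltW // truncnS_gt.
Unshelve. all: by end_near. Qed.

Lemma semigroup_bounded_on_compact t : exists2 M : R, 0 < M &
  forall s f, 0 <= s -> s <= t -> nrm (T s f) <= M * nrm f.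
Proof.
have [d d0 [M M1 hM]] := semigroup_bounded_near0.
have M0 : 0 < M by rewrite (lt_le_trans ltr01).
have H k : forall s f, 0 <= s -> s <= k%:R * d -> nrm (T s f) <= M ^+ k * nrm f.
  elim: k => [|k IH] s f s0.
    rewrite mul0r => s0'; have -> : s = 0 by apply/eqP; rewrite eq_le s0 s0'.
    by rewrite (sg_0 hT) expr0 mul1r.
  rewrite -natr1 mulrDl mul1r => sk; have [sd|sd] := leP s d.
    rewrite (le_trans (hM _ _ s0 sd)) // exprS ler_wpM2r ?nrm_ge0 //.
    by rewrite ler_peMr ?exprn_ege1 // ltW.
  have -> : s = d + (s - d) by rewrite addrC subrK.
  rewrite (sg_D hT) ?(ltW d0) ?subr_ge0 ?(ltW sd) //.
  rewrite (le_trans (hM _ _ (ltW d0) _)) // exprS -mulrA ler_pM2l //.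
  by apply: IH; rewrite ?subr_ge0 ?(ltW sd) // lerBlDr.
exists (M ^+ (Num.truncn (t / d)).+1) => [|s f s0 st]; first by rewrite exprn_gt0.
by apply: H => //; rewrite (le_trans st) // -ler_pdivrMr // ltW // truncnS_gt.
Qed.

Lemma generator_commutes (A : operator X) s f : op_eq A (generator T) -> 0 <= s ->
  dom A f -> dom A (T s f) /\ A (T s f) = T s (A f).
Proof.
move=> hA s0 Af; apply/((generator_graph A T).1 hA).
have hf := ((generator_graph A T).1 hA f (A f)).1 (conj Af erefl).
apply: (near_eq_cvg_to (u := fun h => T s ((h%:C)%C^-1 *: (T h f - f)))).
  near=> h; have h0 : 0 <= h by apply: ltW; near: h; exact: nbhs_right_gt.
  have -> : T h (T s f) = T s (T h f) by rewrite -!(sg_D hT) // addrC.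
  by rewrite linearZ linearB.
by apply: linear_cvg hf; exact: (sg_bounded hT).
Unshelve. all: by end_near. Qed.

End C0_semigroups.

Section compressions.
Context {R : realType} {X : completeNormedModType R[i]}.
Variables (E : set R[i] -> {linear X -> X}) (hE : spectral_measure E).
Variables (D : set R[i]) (mD : borelC D) (ED : forall f, E D f = f).
Variables (A : operator X) (hA : op_eq A (spectral_integral E D id)).
Implicit Types (U : set R[i]) (f : X) (s t h : R).

Lemma bounded_borel_on_cexpt_disc U n t : borelC U -> U `<=` disc n ->
  bounded_borel_on U (cexpt t).
Proof.
move=> mU Un; apply: (@bounded_borel_on_continuous _ setT _ _ (expR (`|t| * n%:R))) => //.
- exact: openT.
- by move=> z _; exact: continuous_cexpt.
- move=> z /Un zn; rewrite nrm_cexpt ler_expR (le_trans (ler_norm _)) // normrM.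
  by rewrite ler_wpM2l // (le_trans (nrm_Re _)).
Qed.

Lemma bounded_borel_on_quot_disc U n h : borelC U -> U `<=` disc n ->
  bounded_borel_on U (quot h).
Proof.
move=> mU Un; apply: bounded_borel_onZ; apply: bounded_borel_onB.
  exact: bounded_borel_on_cexpt_disc Un.
exact: bounded_borel_on_cst.
Qed.

Lemma bounded_borel_on_id U n : borelC U -> U `<=` disc n -> bounded_borel_on U id.
Proof.
move=> mU Un; apply: (@bounded_borel_on_continuous _ setT _ _ n%:R) => //.
  exact: openT.
by move=> z _; exact: cvg_id.
Qed.

(** After projection to a bounded [U], the sequence of truncated integrals defining [A f] is
    eventually constant. *)
Lemma compression_operator U n f : borelC U -> U `<=` D -> U `<=` disc n ->
  dom A f -> E U (A f) = icalc E U id f.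
Proof.
move=> mU UD Un Af.
have h := ((spectral_graph A hE mD).1 hA f (A f)).1 (conj Af erefl).
have h1 : E U (icalc E (D `&` disc k) id f) @[k --> \oo] --> E U (A f).
  by apply: linear_cvg h; exact: (spm_bounded hE).
apply: (nrm_cvg_unique h1); apply: cvg_near_cst; exists n => // k /= nk.
have mk : borelC (D `&` disc k) by apply: borelCI => //; exact: borelC_disc.
rewrite -icalc_setIl //; last exact: (@bounded_borel_on_id _ k).
have -> // : D `&` disc k `&` U = U.
by apply: setIidr => z Uz; split; [exact: UD|rewrite /disc /= (le_trans (Un z Uz)) // ler_nat].
Qed.

Lemma dom_compression n f : dom A (E (D `&` disc n) f).
Proof.
have mn : borelC (D `&` disc n) by apply: borelCI => //; exact: borelC_disc.
have [] // := ((spectral_graph A hE mD).1 hA (E (D `&` disc n) f) (icalc E (D `&` disc n) id f)).2.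
apply: cvg_near_cst; exists n => // k /= nk.
have mk : borelC (D `&` disc k) by apply: borelCI => //; exact: borelC_disc.
rewrite -icalc_setIr //; last exact: (@bounded_borel_on_id _ k).
have -> // : D `&` disc k `&` (D `&` disc n) = D `&` disc n.
by apply: setIidr => z [Dz zn]; split => //; rewrite /disc /= (le_trans zn) // ler_nat.
Qed.

Variables (T : R -> {linear X -> X}) (hT : generates A T).

Let hT0 : C0_semigroup T. Proof. by case: hT. Qed.
Let AT : op_eq A (generator T). Proof. by case: hT. Qed.

(** The path [v s], which runs [T] up to time [s] and the exponential on [U] for the remaining
    [t - s], joins the two sides. Both evolutions have [A] as generator, so its increments are of
    smaller order than [h], uniformly in [s]. *)
Let compression_dom U n f t : borelC U -> U `<=` D -> U `<=` disc n -> 0 <= t ->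
  dom A f -> E U (T t f) = icalc E U (cexpt t) f.
Proof.
move=> mU UD Un t0 Af.
have mex r : bounded_borel_on U (cexpt r) by exact: bounded_borel_on_cexpt_disc Un.
have mq r : bounded_borel_on U (quot r) by exact: bounded_borel_on_quot_disc Un.
have mid : bounded_borel_on U id by exact: bounded_borel_on_id Un.
have [K K0 hK] := icalc_bound hE.
have [M M0 hM] := semigroup_bounded_on_compact hT0 t.
have [N N0 hN] := spm_uniformly_bounded hE.
pose v s := icalc E U (cexpt (t - s)) (T s f).
suff : v t = v 0.
  rewrite /v subrr subr0 (sg_0 hT0) => <-; rewrite -icalc1 //.
  by apply: eq_icalc => z _; rewrite cexpt0.
apply: uniform_increments_constant => // e e0.
have [K1 K10 K1E] : exists2 K1, 0 < K1 & K1 = K * expR (t * n%:R).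
  by exists (K * expR (t * n%:R)) => //; rewrite mulr_gt0 ?expR_gt0.
have f1 : 0 < nrm f + 1 by rewrite ltr_wpDl // nrm_ge0.
pose e1 := e / 2 / (K1 * (N * M)); have e10 : 0 < e1 by rewrite !divr_gt0 // !mulr_gt0.
pose e2 := e / 2 / (K1 * (K * M * (nrm f + 1))).
have e20 : 0 < e2 by rewrite !divr_gt0 // !mulr_gt0.
have [d2 d20 hd2] := @quot_cvg_disc R n e2 e20.
have hAf := ((generator_graph A T).1 AT f (A f)).1 (conj Af erefl).
have /near_at_right0[d1 d10 hd1] : \forall h \near 0^'+,
  nrm ((h%:C)%C^-1 *: (T h f - f) - A f) < e1.
  exact: (nrm_cvgP _ _).1 hAf e1 e10.
exists (Num.min d1 d2); first by rewrite lt_min d10.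
move=> s h h0; rewrite lt_min => /andP[hd1' hd2'] s0 sht.
have hn0 : h != 0 by rewrite gt_eqF.
have st : s <= t by rewrite (le_trans _ sht) // lerDl ltW.
have [ATs ATsE] := generator_commutes hT0 AT s0 Af.
(* [w] is the error of the difference quotient at time [0]; at time [s] the error is [T s w], and
   the bound of [T] on [[0, t]] makes its size independent of [s]. *)
pose g := T s f; pose w := (h%:C)%C^-1 *: (T h f - f) - A f; pose r := t - (s + h).
have r0 : 0 <= r by rewrite subr_ge0.
have TE : E U (T (s + h) f) = E U g + h%:C%C *: (icalc E U id g + E U (T s w)).
  have Th : T h f = f + h%:C%C *: (A f + w).
    by rewrite /w [A f + _]addrC subrK scalerA divff ?C_neq0 // scale1r [f + _]addrC subrK.
  rewrite -(compression_operator mU UD Un ATs) ATsE (sg_D hT0) ?(ltW h0) // Th.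
  by rewrite linearD linearD linearZ linearD /= linearZ linearD.
have exE : icalc E U (cexpt h) g = E U g + h%:C%C *: icalc E U (quot h) g.
  rewrite -icalc1 // -icalcZ // -icalcD //; last exact: bounded_borel_onZ.
    apply: eq_icalc => z _; rewrite /quot mulrA divff ?C_neq0 // mul1r.
    by rewrite addrC subrK.
  exact: bounded_borel_on_cst.
have -> : v (s + h) - v s = icalc E U (cexpt r)
    (h%:C%C *: (E U (T s w) - icalc E U (fun z => quot h z - z) g)).
  have -> : v (s + h) = icalc E U (cexpt r) (E U (T (s + h) f)).
    by rewrite -icalc_setIr // setIid.
  have -> : v s = icalc E U (cexpt r) (icalc E U (cexpt h) g).
    rewrite -icalcM // setIid; apply: eq_icalc => z _.
    by rewrite -cexptD /r opprD addrA subrK.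
  rewrite -icalcB_vec // TE exE icalcB // opprD addrACA subrr add0r -scalerBr.
  by rewrite opprB [_ + E U (T s w)]addrC -addrA.
have exb z : U z -> nrm (cexpt r z) <= expR (t * n%:R).
  move=> /Un zn; rewrite nrm_cexpt ler_expR (le_trans (ler_norm _)) // normrM.
  rewrite ger0_norm // ler_pM //; last by rewrite (le_trans (nrm_Re _)).
  by rewrite /r gerBl addr_ge0 // ltW.
rewrite (le_trans (hK _ _ _ _ (mex r) (expR_ge0 _) exb)) // -K1E.
rewrite nrmZ nrmC gtr0_norm // mulrCA mulrC ler_pM2r //.
have hw : nrm (E U (T s w)) <= N * (M * e1).
  rewrite (le_trans (hN _ _ mU)) // ler_pM2l // (le_trans (hM _ _ s0 st)) // ler_pM2l //.
  by apply: ltW; apply: hd1.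
have hq : nrm (icalc E U (fun z => quot h z - z) g) <= K * e2 * (M * nrm f).
  apply: (@le_trans _ _ (K * e2 * nrm g)).
    apply: hK; [exact: bounded_borel_onB|exact: ltW|] => z /Un zn.
    by apply: hd2 => //; rewrite gtr0_norm.
  by rewrite ler_pM2l; [exact: hM|exact: mulr_gt0].
rewrite mulrC -ler_pdivlMr // (le_trans (nrmB _ _)) // (le_trans (lerD hw hq)) //.
rewrite ler_pdivlMr // mulrDl [leRHS]splitr lerD //.
  rewrite le_eqVlt; apply/orP; left; apply/eqP; rewrite /e1; field.
  by rewrite !gt_eqF.
have -> : K * e2 * (M * nrm f) * K1 = e / 2 * (nrm f / (nrm f + 1)).
  by rewrite /e2; field; rewrite !gt_eqF.
by rewrite ger_pMr ?divr_gt0 // ler_pdivrMr // mul1r lerDl.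
Qed.

(** Both sides are bounded in [f], and the vectors [E (D]&[disc k) f] lie in the domain and tend to
    [f]. *)
Lemma compression_semigroup U n f t : borelC U -> U `<=` D -> U `<=` disc n -> 0 <= t ->
  E U (T t f) = icalc E U (cexpt t) f.
Proof.
move=> mU UD Un t0.
have mex r : bounded_borel_on U (cexpt r) by exact: bounded_borel_on_cexpt_disc Un.
have fE : E (D `&` disc k) f @[k --> \oo] --> f.
  apply: (eq_cvg_to _ (spm_disc_cvg hE (f := f))) => k.
  by rewrite (spm_setI hE) ?ED //; exact: borelC_disc.
have c1 : E U (T t (E (D `&` disc k) f)) @[k --> \oo] --> E U (T t f).
  apply: linear_cvg; first exact: (spm_bounded hE).
  by apply: linear_cvg fE; exact: (sg_bounded hT0).
apply: (nrm_cvg_unique c1).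
apply: (eq_cvg_to _ (icalc_cvg_vec hE (mex t) fE)) => k.
by rewrite (compression_dom mU UD Un t0) //; exact: dom_compression.
Qed.

(** Discs exhaust [D], and the half-plane makes [cexpt t] bounded on all of [D]. In particular the
    semigroup is determined by its generator. *)
Lemma semigroup_is_exponential omega t f : (forall z, D z -> complex.Re z <= omega) ->
  0 <= t -> T t f = icalc E D (cexpt t) f.
Proof.
move=> Do t0.
apply: (nrm_cvg_unique (spm_disc_cvg hE (f := T t f))).
apply: (eq_cvg_to _ (icalc_disc_cvg hE (f := f) (bounded_borel_on_cexpt mD Do t0))) => n.
have mn : borelC (D `&` disc n) by apply: borelCI => //; exact: borelC_disc.
rewrite -(compression_semigroup f mn (@subIsetl _ _ _) (@subIsetr _ _ _) t0).
by rewrite setIC (spm_setI hE) ?ED //; exact: borelC_disc.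
Qed.

End compressions.

(** * The spectrum of the generator *)

Section spectral_bounds.
Context {R : realType} {X : completeNormedModType R[i]}.
Variables (E : set R[i] -> {linear X -> X}) (hE : spectral_measure E).
Implicit Types (U : set R[i]) (f : X) (z : R[i]).

(** A vector [f0] in the range of [E U], for [U] a small neighbourhood of [l] in the support, is an
    approximate eigenvector: [E U (L f0)] differs from [g l *: f0] by at most [K nrm f0], as [g]
    varies by less than [1] on [U]. The constant serves all [L], [g] and [l] at once. *)
Lemma spectral_value_bound : exists2 K : R, 0 < K &
  forall (L : X -> X) (C : R) (g : R[i] -> R[i]) l, 0 <= C ->
    (forall f, nrm (L f) <= C * nrm f) ->
    {for l, continuous (g : R[i]^o -> R[i]^o)} ->
    (forall U n, borelC U -> U `<=` spm_support E -> U `<=` disc n ->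
       bounded_borel_on U g /\ forall f, E U (L f) = icalc E U g f) ->
    spm_support E l -> nrm (g l) <= K * (C + 1).
Proof.
have [M M0 hM] := spm_uniformly_bounded hE; have [K K0 hK] := icalc_bound hE.
exists (M + K); first by rewrite addr_gt0.
move=> L C g l C0 hL cg hg El.
have [d d0 hd] := (nrm_continuous_atP g l).1 cg 1 ltr01.
pose V := [set z | nrm (z - l) < Num.min d 1].
have Vl : V l by rewrite /V /= subrr nrm0 lt_min d0 ltr01.
have oV : open (V : set R[i]^o) by exact: open_disc.
have [f EVf] : exists f, E V f <> 0 by apply/existsNP; exact: El.
pose U := V `&` spm_support E; pose n := (Num.truncn (nrm l + 1)).+1.
have mV : borelC V by exact: borelC_open.
have mU : borelC U by apply: borelCI => //; exact: spm_support_borel.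
have Un : U `<=` disc n.
  move=> z [Vz _]; move: Vz; rewrite /V /= lt_min => /andP[_ zl].
  rewrite /disc /= -(subrK l z) addrC (le_trans (nrmD _ _)) //.
  apply: (@le_trans _ _ (nrm l + 1)); first by rewrite lerD2l ltW.
  by rewrite ltW // truncnS_gt.
have [ug EL] := hg U n mU (@subIsetr _ _ _) Un.
pose f0 := E U f.
have Ef0 : E U f0 = f0 by rewrite /f0 -(spm_setI hE) // setIid.
have f0_gt0 : 0 < nrm f0.
  rewrite lt_def nrm_ge0 andbT nrm_eq0; apply/eqP => f00; apply: EVf.
  by rewrite -f00 /f0 (spm_setI hE) ?(spm_support_full hE) //; exact: spm_support_borel.
have uc : bounded_borel_on U (fun=> g l) by exact: bounded_borel_on_cst.
have h1 : g l *: f0 = E U (L f0) - icalc E U (fun z => g z - g l) f0.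
  by rewrite EL icalcB // icalc_cst // Ef0 opprB addrC subrK.
have h2 : nrm (icalc E U (fun z => g z - g l) f0) <= K * 1 * nrm f0.
  apply: hK => //; first exact: bounded_borel_onB.
  by move=> z [Vz _]; move: Vz; rewrite /V /= lt_min => /andP[zl _]; apply: ltW; exact: hd.
have h3 : nrm (E U (L f0)) <= M * (C * nrm f0).
  by rewrite (le_trans (hM _ _ mU)) // ler_wpM2l // ltW.
rewrite -(ler_pM2r f0_gt0) -nrmZ h1 (le_trans (nrmB _ _)) //.
rewrite (le_trans (lerD h3 h2)) // mulr1 mulrA -mulrDl ler_pM2r //.
have -> : (M + K) * (C + 1) = M * C + K + (K * C + M) by ring.
by rewrite lerDl addr_ge0 ?mulr_ge0 ?(ltW K0) ?(ltW M0).
Qed.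

Variables (A : operator X) (hA : op_eq A (spectral_integral E (spm_support E) id)).
Variables (T : R -> {linear X -> X}) (hT : generates A T).

Let compression U n f t : borelC U -> U `<=` spm_support E -> U `<=` disc n ->
  0 <= t -> E U (T t f) = icalc E U (cexpt t) f.
Proof.
by apply: (compression_semigroup hE (spm_support_borel E) (spm_support_full hE) hA hT).
Qed.

Lemma generates_half_plane :
  exists omega : R, forall z, spm_support E z -> complex.Re z <= omega.
Proof.
have [K K0 hK] := spectral_value_bound.
have [M M0 hM] := semigroup_bounded_on_compact hT.1 1.
exists (ln (K * (M + 1))) => z Ez.
have KM : 0 < K * (M + 1) by rewrite mulr_gt0 // addr_gt0.
rewrite -ler_expR lnK ?posrE // -[complex.Re z]mul1r -nrm_cexpt.
apply: (hK (T 1) M (cexpt 1) z) => //; first exact: ltW.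
- by move=> f; exact: hM.
- exact: continuous_cexpt.
- move=> U n mU US Un; split; first exact: bounded_borel_on_cexpt_disc Un.
  by move=> f; exact: compression US Un _.
Qed.

(** Convergence of the quotients along [h n] at each vector gives, by uniform boundedness, one
    operator bound [C] for all [n]. The symbol of the quotient is [exp(t z) quot (h n) z], bounded
    accordingly at every point of the support. *)
Lemma differentiable_decay t : 0 < t -> (forall f, differentiable_at (fun s => T s f) t) ->
  exists B : R, forall z, spm_support E z -> nrm z * expR (t * complex.Re z) <= B.
Proof.
move=> t_gt0 dT; have t0 := ltW t_gt0; have hT0 := hT.1.
pose h (n : nat) : R := n.+1%:R^-1.
have h0 n : 0 < h n by rewrite invr_gt0 ltr0n.
have th n : 0 <= t + h n by rewrite addr_ge0 // ltW.
have lin n : linear (fun f => ((h n)%:C)%C^-1 *: (T (t + h n) f - T t f)).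
  move=> c f g; rewrite [T (t + h n) _]linearP [T t _]linearP opprD addrACA -scalerBr.
  by rewrite scalerDr !scalerA mulrC.
have [L hL] := choice (fun n => linear_pack (lin n)).
have [n|f|C hC] := @uniform_boundedness R X nat L.
- apply/nrm_continuousP; have [M M0 hM] := semigroup_bounded_on_compact hT0 (t + h n).
  exists ((h n)^-1 * (M + M)) => f; rewrite hL nrmZ nrm_Cinv gtr0_norm // -mulrA.
  rewrite ler_pM2l ?invr_gt0 // mulrDl (le_trans (nrmB _ _)) // lerD // hM //.
  by rewrite lerDl ltW.
- have /cvg_ex[/= y hy] := dT f.
  apply: (@nrm_cvg_bounded _ _ _ y); apply/nrm_cvgP => e e0.
  have /near_dnbhs0[d d0 hd] : \forall k \near 0^',
      nrm ((k%:C)%C^-1 *: (T (t + k) f - T t f) - y) < e.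
    exact: (nrm_cvgP _ _).1 hy e e0.
  near=> n; rewrite hL; apply: hd; first by rewrite gt_eqF.
  rewrite gtr0_norm //; near: n; exact: near_infty_natSinv_lt (PosNum d0).
have [K K0 hK] := spectral_value_bound; have [omega Eomega] := generates_half_plane.
exists (K * (`|C| + 1) + expR (t * omega)) => z Ez.
(* The index [N] may depend on [z] because [C] does not depend on it. Replacing [quot (h N) z] by
   [z] costs an error [1], hence the summand [expR (t * omega)]. *)
have [d d0 hd] := @quot_cvg_disc R (Num.truncn (nrm z)).+1 1 ltr01.
have [N hN] : exists n, h n < d.
  exists (Num.truncn d^-1); rewrite /h invf_plt ?posrE ?ltr0n //.
  exact: truncnS_gt.
have hN0 : h N != 0 by rewrite gt_eqF.
have gE w : ((h N)%:C)%C^-1 * (cexpt (t + h N) w - cexpt t w) = cexpt t w * quot (h N) w.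
  by rewrite cexptD /quot; ring.
have gb : nrm (cexpt t z * quot (h N) z) <= K * (`|C| + 1).
  apply: (hK (L N) `|C| (fun w => cexpt t w * quot (h N) w) z) => //.
  - by move=> f; rewrite (le_trans (hC N f)) // ler_wpM2r ?nrm_ge0 // ler_norm.
  - exact: (cvgM (@continuous_cexpt R t z) (@continuous_quot R (h N) z)).
  - move=> U n mU US Un.
    have mex r : bounded_borel_on U (cexpt r) by exact: bounded_borel_on_cexpt_disc Un.
    have e1 : (fun w => ((h N)%:C)%C^-1 * (cexpt (t + h N) w - cexpt t w)) =
      (fun w => cexpt t w * quot (h N) w) by apply/funext.
    split=> [|f]; rewrite -e1.
      by apply: bounded_borel_onZ; exact: bounded_borel_onB.
    rewrite icalcZ ?icalcB //; last exact: bounded_borel_onB.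
    by rewrite hL linearZ linearB /= !(compression _ mU US Un).
have qz : nrm z <= nrm (quot (h N) z) + 1.
  rewrite -[X in nrm X <= _](subKr (quot (h N) z)) (le_trans (nrmB _ _)) // lerD2l.
  by apply: hd => //; [rewrite gtr0_norm|rewrite /disc /= ltW // truncnS_gt].
rewrite -nrm_cexpt (le_trans (ler_wpM2r (nrm_ge0 _) qz)) // mulrDl mul1r lerD //.
  by rewrite mulrC -nrmM.
by rewrite nrm_cexpt ler_expR ler_wpM2l // Eomega.
Unshelve. all: by end_near. Qed.

End spectral_bounds.

(** * Logarithmic regions and exponential decay *)

Section logarithmic_region.
Context {R : realType}.
Implicit Types (z : R[i]) (omega a b t B : R).

Lemma log_regionP omega a b z : 0 < b -> log_region omega a b z <->
  complex.Re z <= omega /\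
  (complex.Im z != 0 -> complex.Re z <= a - b * ln `|complex.Im z|).
Proof.
move=> b0; have -> : log_region omega a b z = ((complex.Re z)%:E <=
  Order.min omega%:E (a%:E - b%:E * lne `|complex.Im z|%:E))%E :> Prop by [].
rewrite le_min lee_fin.
have [->|y0] := eqVneq (complex.Im z) 0.
  (* Here [b > 0] turns [lne 0 = -oo] into the void bound [+oo]. *)
  rewrite normr0 le0_lneNy // gt0_muleNy ?lte_fin // (_ : a%:E - -oo = +oo)%E // leey andbT.
  by split=> [->|[]].
rewrite lne_EFin ?normr_gt0 // -EFinM -EFinB lee_fin.
by split=> [/andP[-> h]|[-> /(_ isT) ->]].
Qed.

(** Replace [nrm z] by the smaller [|Im z|] and take logarithms. *)
Lemma log_region_of_decay t omega B : 0 < t -> 0 < B ->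
  [set z | complex.Re z <= omega /\ nrm z * expR (t * complex.Re z) <= B]
    `<=` log_region omega (ln B / t) t^-1.
Proof.
move=> t0 B0 z /= [zo zB]; apply/log_regionP; first by rewrite invr_gt0.
split=> // y0; have y_gt0 : 0 < `|complex.Im z| by rewrite normr_gt0.
rewrite [t^-1 * _]mulrC -mulrBl ler_pdivlMr // -ler_expR.
rewrite expRB !lnK ?posrE // ler_pdivlMr // mulrC (mulrC (complex.Re z)).
apply: le_trans zB; rewrite ler_wpM2r ?expR_ge0 //; exact: nrm_Im.
Qed.

Lemma decay_of_log_region omega a b t : 0 < b -> b^-1 <= t ->
  exists B : R, forall z, log_region omega a b z -> nrm z * expR (t * complex.Re z) <= B.
Proof.
move=> b0 bt; have t0 : 0 < t by rewrite (lt_le_trans _ bt) // invr_gt0.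
(* The first two terms bound [|Re z| exp(t Re z)] for negative and nonnegative [Re z]. For the
   imaginary part, [ln |Im z| <= (a - Re z) / b] leaves the exponent [a / b + (t - 1 / b) Re z],
   bounded above because [t >= 1 / b]. *)
exists (t^-1 + `|omega| * expR (t * `|omega|) + expR (a / b + (t - b^-1) * omega)).
move=> z /(log_regionP _ _ _ b0)[xo hy].
rewrite (le_trans (ler_wpM2r (expR_ge0 _) (nrm_ReIm z))) // mulrDl lerD //.
  have [x0|x0] := leP 0 (complex.Re z).
    have xo' : `|complex.Re z| <= `|omega|.
      by rewrite ger0_norm // (le_trans xo) // ler_norm.
    rewrite ler_wpDl ?invr_ge0 ?(ltW t0) // ler_pM ?expR_ge0 //.
    by rewrite ler_expR ler_pM2l // (le_trans _ xo') // ler_norm.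
  rewrite ler_wpDr ?mulr_ge0 ?expR_ge0 // ltr0_norm //.
  rewrite -[t * _]opprK expRN ler_pdivrMr ?expR_gt0 // -ler_pdivrMl ?invr_gt0 // invrK.
  have := expR_ge1Dx (- (t * complex.Re z)); rewrite mulrN; lra.
have [y0|y0] := eqVneq (complex.Im z) 0.
  by rewrite y0 normr0 mul0r expR_ge0.
have y_gt0 : 0 < `|complex.Im z| by rewrite normr_gt0.
rewrite -[`|_|]lnK ?posrE // -expRD ler_expR.
have := hy y0 => {}hy.
have h1 : ln `|complex.Im z| <= (a - complex.Re z) / b.
  by rewrite ler_pdivlMr // mulrC; lra.
have h2 : (t - b^-1) * complex.Re z <= (t - b^-1) * omega.
  by rewrite ler_wpM2l // subr_ge0.
by rewrite mulrBl in h1 h2 *; move: h1 h2; rewrite !mulrBl [complex.Re z / b]mulrC; lra.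
Qed.

(** By [min(k x, 1) <= (k x) ^ (1 - k / t)], the left side is at most [k * k ^ (- k / t) * (x exp(t
    r)) ^ (1 - k / t)]. As [- k ln k <= 1], the second factor is at most [exp(1 / t)]; as [1 <= B],
    the third is at most [B]. The proof takes logarithms throughout. *)
Lemma left_quotient_bound B t k x r : 1 <= B -> 0 < k -> k <= t -> 0 < x ->
  x * expR (t * r) <= B ->
  Num.min (k * x) 1 * expR ((t - k) * r) <= k * (B * expR t^-1).
Proof.
move=> B1 k0 kt x0 xB.
have t0 : 0 < t by exact: lt_le_trans kt.
have B0 : 0 < B by exact: lt_le_trans B1.
have klnk : - (k * ln k) <= 1.
  have := ln_sublinear (x := k^-1); rewrite invr_gt0 => /(_ k0) /ltW.
  rewrite lnV ?posrE // -(ler_pM2l k0) mulrN divff ?gt_eqF //.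
have b0 : 0 <= ln B by exact: ln_ge0.
have hxi : ln x + t * r <= ln B.
  by rewrite -ler_expR expRD !lnK.
have tk : 0 <= t - k by rewrite subr_ge0.
have h1 : (t - k) * (ln x + t * r) <= (t - k) * ln B by rewrite ler_wpM2l.
have kb : 0 <= k * ln B by rewrite mulr_ge0 // ltW.
have [kx|kx] := leP (k * x) 1.
  rewrite -mulrA ler_pM2l // -[x]lnK ?posrE // -[X in _ <= X * _]lnK ?posrE // -!expRD ler_expR.
  have h2 : ln k + ln x <= 0 by rewrite -lnM ?posrE // ln_le0.
  have h3 : k * (ln k + ln x) <= 0 by rewrite mulr_ge0_le0 // ltW.
  rewrite -(ler_pM2l t0) !mulrDr divff ?gt_eqF //.
  by move: h1 h3; lra.
rewrite mul1r -[X in _ <= X * _]lnK ?posrE // -[X in _ * (X * _)]lnK ?posrE // -!expRD ler_expR.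
have h2 : 0 <= ln k + ln x by rewrite -lnM ?posrE // ln_ge0 // ltW.
have h3 : 0 <= (t - k) * (ln k + ln x) by rewrite mulr_ge0.
rewrite -(ler_pM2l t0) !mulrDr divff ?gt_eqF //.
by move: h1 h3; lra.
Qed.

End logarithmic_region.

(** * Differentiability of orbits *)

Section differentiability.
Context {R : realType} {X : completeNormedModType R[i]}.
Variables (E : set R[i] -> {linear X -> X}) (hE : spectral_measure E).
Variables (D : set R[i]) (mD : borelC D).
Variables (omega : R) (Domega : forall z, D z -> complex.Re z <= omega).
Implicit Types (f : X) (t h : R).

(* From the left the quotients are controlled by
   [|1 - exp(k z)| <= C min(k |z|, 1)] and [min(u, 1) <= u ^ (1 - k / t)]. *)
Lemma exponential_differentiable (T : R -> {linear X -> X}) t (B : R) f :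
  (forall t f, 0 <= t -> T t f = icalc E D (cexpt t) f) -> 0 < t ->
  (forall z, D z -> nrm z * expR (t * complex.Re z) <= B) ->
  differentiable_at (fun s => T s f) t.
Proof.
move=> hT t_gt0 hB; have t0 := ltW t_gt0.
pose m := Num.max 0 omega.
have m0 : 0 <= m by rewrite le_max lexx.
have Dm k z : 0 <= k -> k <= 1 -> D z -> k * complex.Re z <= m.
  move=> k0 k1 Dz; rewrite /m le_max; have [z0|z0] := leP (complex.Re z) 0.
    by rewrite mulr_ge0_le0.
  by apply/orP; right; apply: le_trans (Domega Dz); rewrite ger_pMl.
have mex s : 0 <= s -> bounded_borel_on D (cexpt s) := bounded_borel_on_cexpt mD Domega (t := s).
pose G0 z := z * cexpt t z.
have uG0 : bounded_borel_on D G0.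
  apply: (@bounded_borel_on_continuous _ setT _ _ B) => //.
  - exact: openT.
  - by move=> z _; exact: (cvgM (cvg_id (F := nbhs (z : R[i]^o))) (@continuous_cexpt R t z)).
  - by move=> z Dz; rewrite nrmM nrm_cexpt hB.
pose G h z := (h%:C)%C^-1 * (cexpt (t + h) z - cexpt t z).
have tpos : \forall h \near 0^', 0 <= t + h.
  near=> h; have : `|h| < t by near: h; exact: dnbhs0_lt.
  by rewrite ltr_norml => /andP[h1 _]; lra.
apply/cvg_ex; exists (icalc E D G0 f).
apply: (near_eq_cvg_to (u := fun h => icalc E D (G h) f)).
  near=> h; have th : 0 <= t + h by near: h.
  rewrite icalcZ ?icalcB ?hT //; [exact: mex|exact: mex|].
  by apply: bounded_borel_onB; exact: mex.
(* The interpolation bound on the left quotients asks for a constant at least [1]. *)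
pose B' := Num.max B 1; have B1 : 1 <= B' by rewrite le_max lexx orbT.
have B0 : 0 < B' by exact: lt_le_trans B1.
have e1 : 1 <= expR m by rewrite -expR0 ler_expR.
apply: (@icalc_dominated_cvg _ _ _ hE _ _ _ _ _ _ (3 * expR m * (B' * expR t^-1))).
- near=> h; have th : 0 <= t + h by near: h.
  by apply: bounded_borel_onZ; apply: bounded_borel_onB; exact: mex.
- exact: uG0.
- near=> h.
  have th : 0 <= t + h by near: h.
  have h1 : `|h| <= 1 by near: h; exact: dnbhs0_le.
  have h_neq0 : h != 0 by near: h; exact: nbhs_dnbhs_neq.
  move=> z Dz; have zB : nrm z * expR (t * complex.Re z) <= B'.
    by rewrite (le_trans (hB z Dz)) // le_max lexx.
  have [h0|h0] := ltP 0 h.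
    have -> : G h z = cexpt t z * quot h z by rewrite /G cexptD /quot; ring.
    rewrite nrmM nrm_cexpt.
    have hm : h * complex.Re z <= m.
      by apply: Dm => //; [exact: ltW|rewrite (le_trans (ler_norm _))].
    have := nrm_quot h_neq0 m0 hm => hq.
    apply: (@le_trans _ _ (expR (t * complex.Re z) * (3 * nrm z * expR m))).
      by rewrite ler_wpM2l // expR_ge0.
    have -> : expR (t * complex.Re z) * (3 * nrm z * expR m) =
      3 * expR m * (nrm z * expR (t * complex.Re z)) by ring.
    rewrite ler_wpM2l ?mulr_ge0 ?expR_ge0 // (le_trans zB) //.
    by rewrite ler_peMr ?(ltW B0) // -expR0 ler_expR invr_ge0.
  (* For a left increment the factor in front is [exp((t - k) z)], so the decay at time [t] does not
     apply directly. *)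
  pose k := - h; have k0 : 0 < k by rewrite oppr_gt0 lt_def eq_sym h_neq0.
  have kt : k <= t by rewrite lerNl -subr_ge0 opprK addrC.
  have k1 : k <= 1 by apply: le_trans h1; rewrite ler0_norm.
  have -> : G h z = (k%:C)%C^-1 * (cexpt (t - k) z * (cexpt k z - 1)).
    rewrite mulrBr -cexptD subrK mulr1 /G /k opprK rmorphN /= invrN.
    by rewrite mulNr -mulrN opprB.
  have [->|z0] := eqVneq z 0.
    rewrite [cexpt k 0]/cexpt mulr0 cexp0 subrr !mulr0 nrm0.
    by rewrite !mulr_ge0 ?expR_ge0 // ltW.
  have z_gt0 : 0 < nrm z by rewrite lt_def nrm_eq0 z0 nrm_ge0.
  rewrite nrmM nrm_Cinv gtr0_norm // ler_pdivrMl // nrmM nrm_cexpt.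
  have km : k * complex.Re z <= m by apply: Dm => //; exact: ltW.
  (* When [k |z| > 1] the trivial bound [1 + expR m] is used; it is at most [3 expR m] since
     [m >= 0]. *)
  have hk : nrm (cexpt k z - 1) <= 3 * expR m * Num.min (k * nrm z) 1.
    have [kz|kz] := leP (k * nrm z) 1.
      rewrite (le_trans (nrm_cexpt_sub1 m0 km)) // gtr0_norm //.
      by rewrite mulrAC.
    rewrite mulr1 (le_trans (nrmB _ _)) // nrm1 nrm_cexpt.
    have : expR (k * complex.Re z) <= expR m by rewrite ler_expR.
    lra.
  apply: (le_trans (ler_wpM2l (expR_ge0 _) hk)).
  rewrite mulrCA [leRHS]mulrCA ler_wpM2l ?mulr_ge0 ?expR_ge0 // mulrC.
  exact: left_quotient_bound.
- move=> n e e0; have et : 0 < expR (t * omega) by exact: expR_gt0.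
  have [d d0 hd] := @quot_cvg_disc R n (e / expR (t * omega)) (divr_gt0 e0 et).
  near=> h.
  have hd' : `|h| < d by near: h; exact: dnbhs0_lt.
  have h_neq0 : h != 0 by near: h; exact: nbhs_dnbhs_neq.
  move=> z Dz zn.
  have -> : G h z - G0 z = cexpt t z * (quot h z - z) by rewrite /G /G0 cexptD /quot; ring.
  rewrite nrmM nrm_cexpt -[leRHS](divfK (lt0r_neq0 et)) mulrC.
  rewrite ler_pM ?nrm_ge0 ?expR_ge0 //; first exact: hd.
  by rewrite ler_expR ler_wpM2l // Domega.
Unshelve. all: by end_near. Qed.

End differentiability.

(** * The semigroup operators *)

Section image_spectral_measure.
Context {R : realType} {X : completeNormedModType R[i]}.
Variables (E : set R[i] -> {linear X -> X}) (hE : spectral_measure E).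
Variables (D : set R[i]) (mD : borelC D) (ED : forall f, E D f = f).
Variables (G : R[i] -> R[i]) (cG : continuous (G : R[i]^o -> R[i]^o)).
Variables (r : R) (Gr : forall z, D z -> nrm (G z) <= r).
Variables (S : {linear X -> X}) (SE : forall f, S f = icalc E D G f).
Implicit Types (B U V : set R[i]) (f : X).

(** As [D] has full measure, cutting the preimage down to [D] does not change the projection, and
    integrals against the image become integrals over [D]. *)
Definition spm_image B : {linear X -> X} := E (D `&` G @^-1` B).

Let mpre B : borelC B -> borelC (D `&` G @^-1` B).
Proof.
apply: borelC_preimage => //; apply: (@borel_on_continuous _ setT) => //.
  exact: openT.
by move=> z _; exact: cG.
Qed.

Lemma spm_image_spectral_measure : spectral_measure spm_image.
Proof.
split.
- by move=> B mB; apply: (spm_bounded hE); exact: mpre.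
- by move=> f; rewrite /spm_image preimage_set0 setI0 (spm_set0 hE).
- by move=> f; rewrite /spm_image preimage_setT setIT.
- move=> B B' mB mB' f; rewrite /spm_image -(spm_setI hE) ?mpre //; try exact: mpre.
  by rewrite preimage_setI setIACA setIid.
- move=> B mB tB f; rewrite /spm_image preimage_bigcup setI_bigcupr.
  apply: (@spm_sigma_additive _ _ _ hE (fun k => D `&` G @^-1` B k)).
    by move=> n; exact: mpre.
  apply/trivIsetP => i j _ _ ij; rewrite setIACA -preimage_setI.
  by move/trivIsetP : tB => -> //; rewrite preimage_set0 setI0.
Qed.

Let hF := spm_image_spectral_measure.

(** Change of variables: pulling the sets of a step function back along [G] composes it with [G],
    which preserves uniform approximation, and leaves the formal integral unchanged. *)
Lemma calc_image H f : step_limit H ->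
  calc spm_image H f = calc E (fun z => H (G z) * \1_D z) f.
Proof.
move=> [L aL]; have [mL hL] := aL.
pose L' n := [seq (p.1, D `&` G @^-1` p.2) | p <- L n].
have aL' : approximates (fun z => H (G z) * \1_D z) L'.
  split=> [n _ /mapP[p pL ->]|e e0]; first exact: mpre (mL n p pL).
  have := hL e e0; apply: filterS => n hn z.
  have -> : step_fun (L' n) z = step_fun (L n) (G z) * \1_D z.
    rewrite /step_fun big_map mulr_suml; apply: eq_bigr => p _.
    by rewrite indicI /= [\1_D z * _]mulrC mulrA.
  rewrite -mulrBl nrmM indicE; case: (z \in D); first by rewrite nrm1 mulr1.
  by rewrite nrm0 mulr0.
apply/esym/(calcE hE aL').
apply: (eq_cvg_to _ (calc_cvg hF (f := f) aL)) => n.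
by rewrite /step_int big_map.
Qed.

Lemma icalc_image B n f : borelC B -> B `<=` disc n ->
  icalc spm_image B id f = icalc E (D `&` G @^-1` B) G f.
Proof.
move=> mB Bn; rewrite /icalc calc_image; last exact: bounded_borel_on_id Bn.
by congr calc; apply/funext => z; rewrite indicI /= [\1_D z * _]mulrC mulrA.
Qed.

Let uG : bounded_borel_on D G.
Proof.
apply: (@bounded_borel_on_continuous _ setT _ _ r) => //; first exact: openT.
by move=> z _; exact: cG.
Qed.

Let uGz z : bounded_borel_on D (fun w => G w - z).
Proof. by apply: bounded_borel_onB => //; exact: bounded_borel_on_cst. Qed.

Let SzE z f : S f - z *: f = icalc E D (fun w => G w - z) f.
Proof. by rewrite SE icalcB ?icalc_cst ?ED //; exact: bounded_borel_on_cst. Qed.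

Let continuous_S : continuous S.
Proof.
have [L [cL hL]] := icalc_pack hE uG.
by have -> : (S : X -> X) = L by apply/funext => f; rewrite SE hL.
Qed.

(** If a disc around [z] has measure zero, [G] stays at distance at least [d] from [z] on a set [D']
    of full measure, and the integral of the bounded function [(G - z)^-1] over [D'] is the
    resolvent. *)
Let resolvent_setC_support z : ~ spm_support spm_image z ->
  resolvent_set (everywhere_defined S) z.
Proof.
move=> /existsNP[U /not_implyP[oU /not_implyP[Uz /contrapT FU]]].
have [d d0 hd] := (nrm_openC U).1 oU z Uz.
pose D' := D `&` G @^-1` [set w | d <= nrm (w - z)].
have mV : borelC [set w : R[i] | nrm (w - z) < d] by apply: borelC_open; exact: open_disc.
have VC : [set w : R[i] | d <= nrm (w - z)] = ~` [set w | nrm (w - z) < d].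
  by apply/seteqP; split=> w /=; rewrite leNgt => /negP.
have mD' : borelC D' by apply: mpre; rewrite VC; exact: borelCC.
have ED' f : E D' f = f.
  rewrite -[LHS]/(spm_image _ f) VC (spm_setC hF) //.
  have VU : [set w : R[i] | nrm (w - z) < d] `<=` U by move=> w; exact: hd.
  have mU : borelC U by exact: borelC_open.
  by rewrite -(setIidl VU) (spm_setI hF mV mU) FU linear0 subr0.
have Gz w : D' w -> G w - z != 0.
  by move=> [_ /= dw]; rewrite -nrm_eq0 gt_eqF // (lt_le_trans d0).
have cGz w : {for w, continuous ((fun w => G w - z) : R[i]^o -> R[i]^o)}.
  by apply: continuousB; [exact: cG|exact: cst_continuous].
have ug : bounded_borel_on D' (fun w => (G w - z)^-1).
  apply: (@bounded_borel_on_continuous _ (G @^-1` [set w | w - z != 0]) _ _ d^-1);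
    [|exact: mD'|exact: Gz| |].
  - apply/nrm_openC => w /= wz.
    have wz0 : 0 < nrm (G w - z) by rewrite lt_def nrm_eq0 wz nrm_ge0.
    have cGw : {for w, continuous (G : R[i]^o -> R[i]^o)} by exact: cG.
    have [e e0 he] := (nrm_continuous_atP G w).1 cGw _ wz0.
    exists e => // w' /he; apply: contraTneq => w'z.
    have -> : G w' = z by apply/eqP; rewrite -subr_eq0 w'z.
    by rewrite nrmBC ltxx.
  - by move=> w wz; exact: (cvgV wz (cGz w)).
  - move=> w [_ /= dw]; rewrite nrmV lef_pV2 ?posrE //.
    exact: lt_le_trans dw.
have uD' : bounded_borel_on D' (fun w => G w - z).
  have -> : D' = D `&` D' by rewrite /D' setIA setIid.
  by apply: bounded_borel_on_setI.
have SzE' f : S f - z *: f = icalc E D' (fun w => G w - z) f.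
  have -> : D' = D `&` D' by rewrite /D' setIA setIid.
  by rewrite icalc_setIr // ED' SzE.
have [L [cL hL]] := icalc_pack hE ug.
exists L; split=> //; split=> f.
  split=> //; rewrite SzE' hL -icalcM // setIid -[RHS]ED' -icalc1 //.
  by apply: eq_icalc => w /Gz; exact: mulfV.
move=> _; rewrite SzE' hL -icalcM // setIid -[RHS]ED' -icalc1 //.
by apply: eq_icalc => w /Gz; exact: mulVf.
Qed.

(** Near a point of the support there are approximate eigenvectors, which a bounded inverse
    excludes. *)
Let resolvent_set_support z : resolvent_set (everywhere_defined S) z ->
  ~ spm_support spm_image z.
Proof.
move=> [L [cL [_ LS]]] Fz.
have [C hC] := (nrm_continuousP L).1 cL; have [K K0 hK] := icalc_bound hE.
(* Chosen so that the bounded inverse would give [nrm f0 <= nrm f0 / 2]. *)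
pose d := (2 * (`|C| + 1) * K)^-1.
have C1 : 0 < `|C| + 1 by rewrite ltr_wpDl.
have d0 : 0 < d by rewrite invr_gt0 !mulr_gt0.
pose V := [set w : R[i] | nrm (w - z) < d].
have oV : open (V : set R[i]^o) by exact: open_disc.
have mV : borelC V by exact: borelC_open.
have [f FVf] : exists f, spm_image V f <> 0.
  by apply/existsNP; apply: Fz => //; rewrite /V /= subrr nrm0.
pose f0 := spm_image V f.
have Ff0 : spm_image V f0 = f0 by rewrite /f0 -(spm_setI hF) // setIid.
have f0_gt0 : 0 < nrm f0.
  by rewrite lt_def nrm_ge0 andbT nrm_eq0; apply/eqP.
have h1 : S f0 - z *: f0 = icalc E (D `&` (D `&` G @^-1` V)) (fun w => G w - z) f0.
  by rewrite (icalc_setIr hE f0 (mpre mV) (uGz z)) -[E _ f0]/(spm_image V f0) Ff0 SzE.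
have h2 : nrm (S f0 - z *: f0) <= K * d * nrm f0.
  rewrite h1; apply: hK; [|exact: ltW|by move=> w [_ [_ /= /ltW]]].
  by apply: bounded_borel_on_setI => //; exact: mpre.
have : nrm f0 <= (`|C| + 1) * (K * d * nrm f0).
  rewrite -{1}[f0](LS f0) //= (le_trans (hC _)) //.
  apply: (@le_trans _ _ ((`|C| + 1) * nrm (S f0 - z *: f0))).
    by rewrite ler_wpM2r ?nrm_ge0 // (le_trans (ler_norm _)) // lerDl.
  by rewrite ler_pM2l.
have -> : (`|C| + 1) * (K * d * nrm f0) = nrm f0 / 2.
  by rewrite /d; field; rewrite !gt_eqF.
lra.
Qed.

Lemma spm_image_scalar_type : scalar_type_spectral (everywhere_defined S).
Proof.
have suppE : spm_support spm_image = spectrum (everywhere_defined S).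
  apply/seteqP; split=> z; first by move=> Fz /resolvent_set_support.
  by move=> nz; apply: contrapT => /resolvent_setC_support.
split.
- by split=> // c f g _ _; split=> //=; rewrite linearP.
- by move=> O O0 _; rewrite setIT.
- rewrite /op_closed; have -> : [set p : X * X | dom (everywhere_defined S) p.1 /\
      p.2 = everywhere_defined S p.1]
      = (fun p : X * X => p.2 - S p.1) @^-1` [set 0].
    apply/seteqP; split=> p /=; first by move=> [_ ->]; rewrite subrr.
    by move=> /eqP; rewrite subr_eq0 => /eqP.
  apply: preimage_closed => [p _|]; last first.
    by apply: accessible_closed_set1; apply: hausdorff_accessible; exact: norm_hausdorff.
  apply: continuousB; first exact: cvg_snd.
  by apply: continuous_comp; [exact: cvg_fst|exact: continuous_S].
- exists spm_image; split=> //; rewrite -suppE.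
  have mF := spm_support_borel spm_image.
  apply/(spectral_graph _ hF mF) => f y.
  have SF : icalc spm_image (spm_support spm_image `&` disc n) id f @[n --> \oo] --> S f.
    (* Beyond [r] the truncation is void, because [G] is bounded by [r] on [D]; the spectral
       integral of [id] is then the everywhere defined [S]. *)
    apply: cvg_near_cst; exists (Num.truncn r).+1 => // n /= rn.
    have mFn : borelC (spm_support spm_image `&` disc n).
      by apply: borelCI => //; exact: borelC_disc.
    rewrite (icalc_image _ mFn (@subIsetr _ _ _)).
    have -> : D `&` G @^-1` (spm_support spm_image `&` disc n) =
        D `&` (D `&` G @^-1` spm_support spm_image).
      apply/seteqP; split=> z; first by move=> [Dz [Fz _]].
      move=> [Dz [_ Fz]]; split=> //; split=> //.
      rewrite /disc /= (le_trans (Gr Dz)) //.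
      by rewrite (le_trans (ltW (truncnS_gt _))) // ler_nat.
    rewrite icalc_setIr //; last exact: mpre.
    by rewrite -[E _ f]/(spm_image _ f) spm_support_full // SE.
  split=> [[_ <-] //|hy]; split => //=.
  exact: nrm_cvg_unique SF hy.
Qed.

End image_spectral_measure.

(** * The equivalence, the type of the semigroup operators and the time of smoothing *)

Theorem theorem4p3 (R : realType) (X : completeNormedModType R[i])
    (A : operator X) (hA : scalar_type_spectral A) :
  [/\ (exists T : R -> {linear X -> X},
         generates A T /\ eventually_differentiable T)
      <-> (exists omega b a : R,
             0 < b /\ spectrum A `<=` log_region omega a b),
      forall T : R -> {linear X -> X},
        generates A T -> eventually_differentiable T ->
        forall t, 0 <= t -> scalar_type_spectral (everywhere_defined (T t))
    & forall omega b a : R,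
        0 < b -> spectrum A `<=` log_region omega a b ->
        forall T : R -> {linear X -> X}, generates A T ->
        orbits_differentiable_from T b^-1].
Proof.
have [_ _ _ [E [hE suppE hAE]]] := hA.
rewrite -suppE in hAE *.
have mD := spm_support_borel E; have ED := spm_support_full hE.
have region omega b a : 0 < b -> spm_support E `<=` log_region omega a b ->
    forall z, spm_support E z -> complex.Re z <= omega.
  by move=> b0 hD z /hD /(log_regionP _ _ _ b0)[].
have smooth omega b a (T : R -> {linear X -> X}) :
    0 < b -> spm_support E `<=` log_region omega a b ->
    (forall t f, 0 <= t -> T t f = icalc E (spm_support E) (cexpt t) f) ->
    orbits_differentiable_from T b^-1.
  move=> b0 hD hT f t bt; have [B hB] := decay_of_log_region omega a b0 bt.
  apply: (exponential_differentiable hE mD (region _ _ _ b0 hD) (B := B) hT).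
    by rewrite (lt_le_trans _ bt) // invr_gt0.
  by move=> z /hD; exact: hB.
split.
- split=> [[T [gT [t0 t0_gt0 dT]]]|[omega [b [a [b0 hD]]]]].
    have [omega ho] := generates_half_plane hE hAE gT.
    have [B hB] := differentiable_decay hE hAE gT t0_gt0 (fun f => dT f t0 (lexx _)).
    (* The maximum with [1] makes the argument of the logarithm positive. *)
    exists omega, t0^-1, (ln (Num.max B 1) / t0); split; first by rewrite invr_gt0.
    have B0 : 0 < Num.max B 1 by rewrite lt_max ltr01 orbT.
    move=> z Dz; apply: log_region_of_decay => //; split; first exact: ho.
    by rewrite le_max hB.
  have [T hT] := exponential_semigroup_exists hE mD (region _ _ _ b0 hD).
  exists T; split; first exact: (exponential_generates hE mD ED (region _ _ _ b0 hD)).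
  by exists b^-1; [rewrite invr_gt0|exact: (smooth _ _ _ _ b0 hD hT)].
- move=> T gT _ t t0; have [omega ho] := generates_half_plane hE hAE gT.
  apply: (@spm_image_scalar_type _ _ _ hE _ mD ED (cexpt t) (@continuous_cexpt R t)
    (expR (t * omega))).
  + by move=> z Dz; rewrite nrm_cexpt ler_expR ler_wpM2l // ho.
  + by move=> f; exact: (semigroup_is_exponential hE mD ED hAE gT f ho).
(* Here [T] is an arbitrary semigroup generated by [A]; uniqueness identifies it with the
   exponential one, to which the smoothing applies. *)
- move=> omega b a b0 hD T gT; apply: (smooth _ _ _ _ b0 hD) => t f t0.
  exact: (semigroup_is_exponential hE mD ED hAE gT f (region _ _ _ b0 hD)).
Qed.
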